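(* Let $T$ be a complete continuous theory in a countable continuous language, $M\models T$ an $\omega$-saturated model, and $\varphi(x,y)$ a $[0,1]$-valued formula which is $\delta$-stable in $T$. Let $\mu$ and $\nu$ be Keisler measures on $S_\varphi(M)$ and $S_{\varphi^*}(M)$ respectively, and fix $\epsilon>0$. Then there are $m,n\geq 1$ such that for every $\gamma\in(0,1)$ there are partitions $M^x=A_0\cup A_1\cup\ldots\cup A_m$ and $M^y=B_0\cup B_1\cup\ldots\cup B_n$ such that: (1) $A_1,\ldots,A_m$ are explicit $\varphi$-zerosets and $B_1,\ldots,B_n$ are explicit $\varphi^*$-zerosets; (2) for all $(i,j)\in[m]\times[n]$, $(A_i,B_j)$ is $(5\delta;\gamma)$-homogeneous for $\mu$ and $\nu$ (with respect to the function $\varphi^M\colon M^x\times M^y\to[0,1]$); (3) $\mu(A_0)\leq\epsilon\mu(A_1)$ and $\nu(B_0)\leq\epsilon\nu(B_1)$.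
   Context: $\varphi(x,y)$ is $\delta$-stable in $T$ if for every model $N\models T$ there are no $a_i\in N^x$, $b_i\in N^y$ ($i\in\mathbb{N}$) with $|\varphi(a_i,b_j)-\varphi(a_j,b_i)|\geq\delta$ for all $i<j$. $\varphi^*(y,x)$ denotes $\varphi(x,y)$ with the roles of object and parameter variables exchanged. $S_\varphi(M)$ is the compact Hausdorff space of complete local $\varphi$-types over $M$; a Keisler measure on it is a regular Borel probability measure. An explicit $\varphi$-zeroset is a subset of $M^x$ in the lattice (closure under finite unions and intersections) generated by the sets $\{a\in M^x:\varphi(a,b)\in D\}$ with $b\in M^y$ and $D\subseteq\mathbb{R}$ closed; explicit $\varphi^*$-zerosets in $M^y$ are defined symmetrically. Since $M$ is $\omega$-saturated, $\mu$ induces a finitely additive probability measure (also denoted $\mu$) on the Boolean algebra of subsets of $M^x$ generated by explicit $\varphi$-zerosets, assigning to such a set the $\mu$-measure of the corresponding set of types in $S_\varphi(M)$; similarly for $\nu$. Homogeneity: for $f\colon V\times W\to[0,1]$ and finitely additive probability measures $\mu,\nu$ on Boolean algebras $\mathcal{A},\mathcal{B}$ on $V,W$, a pair $(V_*,W_* )\in\mathcal{A}\times\mathcal{B}$ is $(\delta;\gamma)$-homogeneous if there are $V'\subseteq V_*$, $W'\subseteq W_*$ with $V'\in\mathcal{A}$, $\mu(V')\geq(1-\gamma)\mu(V_* )$, $W'\in\mathcal{B}$, $\nu(W')\geq(1-\gamma)\nu(W_* )$, some $r\in[0,1]$ with $\mu(\{a\in V_*:|f(a,b)-r|\leq\delta\})\geq(1-\gamma)\mu(V_*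 )$ for all $b\in W'$, and some $s\in[0,1]$ with $\nu(\{b\in W_*:|f(a,b)-s|\leq\delta\})\geq(1-\gamma)\nu(W_* )$ for all $a\in V'$. *)

(* Defs.v *)
From HB Require Import structures.
From mathcomp Require Import all_boot all_order all_algebra.
From mathcomp Require Import all_classical all_reals all_analysis.

Set Implicit Arguments.
Unset Strict Implicit.
Unset Printing Implicit Defensive.

Import Order.TTheory GRing.Theory Num.Theory.
Import numFieldTopology.Exports.

Local Open Scope classical_set_scope.
Local Open Scope ring_scope.

(* Continuous (many-sorted) languages and metric structures, following
   Ben Yaacov--Berenstein--Henson--Usvyatsov.  [fmod f] and [pmod P] are the
   prescribed moduli of uniform continuity, [diam s] is the prescribed bound
   on the metric of sort [s], and [[plow P, phigh P]] is the range of [P]. *)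
Record language (R : realType) := Language {
  lsort : Type;
  diam : lsort -> R;
  funsym : Type;
  farity : funsym -> nat;
  fdom : forall f : funsym, 'I_(farity f) -> lsort;
  fcod : funsym -> lsort;
  fmod : funsym -> R -> R;
  fmod_gt0 : forall f (e : R), 0 < e -> 0 < fmod f e;
  relsym : Type;
  parity : relsym -> nat;
  pdom : forall P : relsym, 'I_(parity P) -> lsort;
  plow : relsym -> R;
  phigh : relsym -> R;
  pmod : relsym -> R -> R;
  pmod_gt0 : forall P (e : R), 0 < e -> 0 < pmod P e
}.

Arguments fdom {R l} f i.
Arguments pdom {R l} P i.

Definition countable_language (R : realType) (L : language R) : Prop :=
  [/\ countable [set: lsort L], countable [set: funsym L]
    & countable [set: relsym L]].

Record structure (R : realType) (L : language R) := Structure {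
  car : lsort L -> metricType R;
  car_nonempty : forall s, inhabited (car s);
  car_complete : forall s (F : set_system (car s)),
    ProperFilter F -> cauchy F -> exists l : car s, F --> l;
  car_diam : forall s (a b : car s), mdist a b <= diam s;
  fint : forall f : funsym L, (forall i, car (fdom f i)) -> car (fcod f);
  fint_unif : forall (f : funsym L) (a b : forall i, car (fdom f i)) (e : R),
    0 < e -> (forall i, mdist (a i) (b i) < fmod f e) ->
    mdist (@fint f a) (@fint f b) <= e;
  pint : forall P : relsym L, (forall i, car (pdom P i)) -> R;
  pint_range : forall (P : relsym L) (a : forall i, car (pdom P i)),
    plow P <= @pint P a <= phigh P;
  pint_unif : forall (P : relsym L) (a b : forall i, car (pdom P i)) (e : R),
    0 < e -> (forall i, mdist (a i) (b i) < pmod P e) ->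
    `|@pint P a - @pint P b| <= e
}.

Arguments fint {R L} s f a : rename.
Arguments pint {R L} s P a : rename.

(* A tuple of variables is a finite type [V] together with a sort assignment
   [vs]; [tup M vs] is the corresponding product of sorts of [M]. *)
Definition tup (R : realType) (L : language R) (M : structure L)
    (V : Type) (vs : V -> lsort L) : Type := forall v : V, car M (vs v).

Section Formulas.
Context {R : realType} {L : language R}.

(* The variables [V] extended by a stack [bs] of variables bound by
   quantifiers, the innermost being [None]. *)
Fixpoint vars (V : Type) (bs : seq (lsort L)) : Type :=
  if bs is _ :: bs' then option (vars V bs') else V.

Fixpoint vsort (V : Type) (vs : V -> lsort L) (bs : seq (lsort L)) :
    vars V bs -> lsort L :=
  match bs return vars V bs -> lsort L with
  | [::] => vs
  | s :: bs' => fun o => if o is Some v then vsort vs v else s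
  end.

Definition joinv (V W : Type) (vs : V -> lsort L) (ws : W -> lsort L) :
  V + W -> lsort L :=
  fun u => match u with inl v => vs v | inr w => ws w end.

Inductive term (V : Type) (vs : V -> lsort L) : lsort L -> Type :=
| Var (v : V) : term vs (vs v)
| App (f : funsym L) (t : forall i, term vs (fdom f i)) : term vs (fcod f).

(* [bformula vs bs] is the type of formulas with free variables among [vs] and
   [bs]; connectives are arbitrary continuous maps from [R^n] to [R]. *)
Inductive bformula (V : Type) (vs : V -> lsort L) : seq (lsort L) -> Type :=
| Dist bs (s : lsort L) (t u : term (@vsort V vs bs) s) : bformula vs bs
| Pred bs (P : relsym L) (t : forall i, term (@vsort V vs bs) (pdom P i)) :
    bformula vs bs
| Conn bs (n : nat) (u : 'rV[R]_n -> R) (cu : continuous u)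
    (psi : 'I_n -> bformula vs bs) : bformula vs bs
| Sup bs (s : lsort L) (psi : bformula vs (s :: bs)) : bformula vs bs
| Inf bs (s : lsort L) (psi : bformula vs (s :: bs)) : bformula vs bs.

Definition formula (V : Type) (vs : V -> lsort L) : Type := bformula vs [::].

Definition sentence : Type := formula (of_void (lsort L)).

Definition pusht (M : structure L) (V : Type) (vs : V -> lsort L)
    (bs : seq (lsort L)) (s : lsort L) (a : tup M (@vsort V vs bs))
    (c : car M s) : tup M (@vsort V vs (s :: bs)) :=
  fun o => match o with Some v => a v | None => c end.

Definition joint (M : structure L) (V W : Type) (vs : V -> lsort L)
    (ws : W -> lsort L) (a : tup M vs) (b : tup M ws) : tup M (joinv vs ws) :=
  fun u => match u with inl v => a v | inr w => b w end.

Fixpoint teval (M : structure L) (V : Type) (vs : V -> lsort L) (s : lsort L)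
    (t : term vs s) (a : tup M vs) : car M s :=
  match t with
  | Var v => a v
  | App f t => fint M f (fun i => teval (t i) a)
  end.

Fixpoint beval (M : structure L) (V : Type) (vs : V -> lsort L)
    (bs : seq (lsort L)) (psi : bformula vs bs) : tup M (@vsort V vs bs) -> R :=
  match psi in bformula _ bs return tup M (@vsort V vs bs) -> R with
  | Dist _ _ t u => fun a => mdist (teval t a) (teval u a)
  | Pred _ P t => fun a => pint M P (fun i => teval (t i) a)
  | Conn _ _ u _ psi => fun a => u (\row_i beval (psi i) a)
  | Sup _ _ psi => fun a => sup [set beval psi (pusht a c) | c in setT]
  | Inf _ _ psi => fun a => inf [set beval psi (pusht a c) | c in setT]
  end.

Definition feval (M : structure L) (V : Type) (vs : V -> lsort L)
  (psi : formula vs) (a : tup M vs) : R := @beval M V vs [::] psi a.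

Definition notup (M : structure L) : tup M (of_void (lsort L)) :=
  fun v => match v with end.

Definition seval (M : structure L) (sigma : sentence) : R :=
  feval sigma (@notup M).

(* A theory is a set of closed conditions [sigma = 0]. *)
Definition theory : Type := set sentence.

Definition models (M : structure L) (T : theory) : Prop :=
  forall sigma, T sigma -> seval M sigma = 0.

Definition complete_theory (T : theory) : Prop :=
  (exists M, models M T) /\
  forall sigma, exists r : R, forall M, models M T -> seval M sigma = r.

Definition elementary (M N : structure L)
    (h : forall s, car M s -> car N s) : Prop :=
  forall (V : finType) (vs : V -> lsort L) (psi : formula vs) (a : tup M vs),
    feval psi (fun v => h _ (a v)) = feval psi a.

(* The finite parameter set is enumerated by the tuple [c]; [G] is a set of
   conditions [psi(x, c) = 0] in finitely many variables [x]. *)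
Definition omega_saturated (M : structure L) : Prop :=
  forall (p x : finType) (ps : p -> lsort L) (xs : x -> lsort L)
    (c : tup M ps) (G : set (formula (joinv xs ps))),
    (forall F, finite_set F -> F `<=` G ->
       exists a : tup M xs, forall psi, F psi -> feval psi (joint a c) = 0) ->
    exists a : tup M xs, forall psi, G psi -> feval psi (joint a c) = 0.

(* Functions [(a, b) |-> Phi N a b] of an object tuple and a parameter tuple,
   given uniformly over all structures; exchanging the roles of the object
   and parameter variables of a formula is then just [swapb]. *)
Definition bpred (x y : finType) (xs : x -> lsort L) (ys : y -> lsort L) : Type :=
  forall N : structure L, tup N xs -> tup N ys -> R.

Definition interp (x y : finType) (xs : x -> lsort L) (ys : y -> lsort L)
    (phi : formula (joinv xs ys)) : bpred xs ys :=
  fun N a b => feval phi (joint a b).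
Arguments interp {x y xs ys} phi N a b.

Definition swapb (x y : finType) (xs : x -> lsort L) (ys : y -> lsort L)
    (Phi : bpred xs ys) : bpred ys xs := fun N b a => Phi N a b.

Definition unit_valued (x y : finType) (xs : x -> lsort L) (ys : y -> lsort L)
    (T : theory) (phi : formula (joinv xs ys)) : Prop :=
  forall N, models N T -> forall a b, 0 <= interp phi N a b <= 1.

Definition stable (x y : finType) (xs : x -> lsort L) (ys : y -> lsort L)
    (T : theory) (phi : formula (joinv xs ys)) (delta : R) : Prop :=
  forall N, models N T ->
    ~ exists (a : nat -> tup N xs) (b : nat -> tup N ys),
        forall i j, (i < j)%N ->
          delta <= `|interp phi N (a i) (b j) - interp phi N (a j) (b i)|.

End Formulas.

Arguments theory {R} L.
Arguments interp {R L x y xs ys} phi N a b.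
Arguments swapb {R L x y xs ys} Phi N b a.
Arguments unit_valued {R L x y xs ys} T phi.
Arguments stable {R L x y xs ys} T phi delta.

Section LocalTypes.
Context {R : realType} {L : language R} {x y : finType}.
Context {xs : x -> lsort L} {ys : y -> lsort L}.
Variables (Phi : bpred xs ys) (M : structure L).

(* A complete local type is identified with the function
   [b |-> Phi(p, b)] giving the values that it assigns. *)
Definition is_local_type (p : tup M ys -> R) : Prop :=
  exists (N : structure L) (h : forall s, car M s -> car N s) (a : tup N xs),
    elementary h /\ forall b : tup M ys, p b = @Phi N a (fun v => h _ (b v)).

Definition local_type : Type :=
  set_type [set p : {ptws (tup M ys) -> R} | is_local_type p].

HB.instance Definition _ := Topological.on local_type.

Definition type_val (p : local_type) (b : tup M ys) : R := (\val p : _ -> R) b.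

Lemma is_local_type_realized (a : tup M xs) : is_local_type (@Phi M a).
Proof. by exists M, (fun=> id), a. Qed.

Definition tp (a : tup M xs) : local_type :=
  exist _ (@Phi M a : {ptws (tup M ys) -> R})
    (mem_set (is_local_type_realized a)).

Definition some_tup : tup M xs :=
  fun v => projT1 (cid (let: inhabits c := car_nonempty M (xs v) in
                        ex_intro (fun=> True) c I)).

HB.instance Definition _ := isPointed.Build local_type (tp some_tup).

Definition borel_local_type := g_sigma_algebraType (@open local_type).

Definition regular_measure (mu : set local_type -> \bar R) : Prop :=
  forall A, <<s @open local_type >> A ->
    mu A = ereal_sup [set mu K | K in [set K | compact K /\ K `<=` A]] /\
    mu A = ereal_inf [set mu U | U in [set U | open U /\ A `<=` U]].

Definition explicit_basic : set (set (tup M xs)) :=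
  [set X | exists (b : tup M ys) (D : set R),
    closed D /\ X = [set a | D (@Phi M a b)]].

Definition explicit_zeroset : set (set (tup M xs)) :=
  smallest (fun C => setU_closed C /\ setI_closed C) explicit_basic.

Definition boolean_algebra (X : Type) (C : set (set X)) : Prop :=
  [/\ C set0, setC_closed C & setU_closed C].

Definition explicit_algebra : set (set (tup M xs)) :=
  smallest (@boolean_algebra _) explicit_zeroset.

Definition type_algebra : set (set local_type) :=
  smallest (@boolean_algebra _)
    [set Y | exists (b : tup M ys) (D : set R),
      closed D /\ Y = [set p | D (type_val p b)]].

(* Every [X] in [explicit_algebra] is [tp @^-1` Y] for some [Y] in
   [type_algebra], namely the set of types defined by the same Boolean
   combination; [Y] is unique when [M] is omega-saturated, because then every
   local type agrees with a realized one on any finite set of parameters. *)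
Definition type_set (X : set (tup M xs)) : set local_type :=
  xget set0 [set Y | type_algebra Y /\ tp @^-1` Y = X].

Definition induced_measure (mu : set local_type -> \bar R) (X : set (tup M xs)) : R :=
  fine (mu (type_set X)).

End LocalTypes.

Arguments type_val {R L x y xs ys Phi M} p b.
Arguments explicit_zeroset {R L x y xs ys} Phi M X : rename.
Arguments explicit_algebra {R L x y xs ys} Phi M X : rename.
Arguments regular_measure {R L x y xs ys Phi M} mu.
Arguments induced_measure {R L x y xs ys Phi M} mu X.
Arguments type_set {R L x y xs ys} Phi {M} X.

Definition homogeneous (R : realType) (V W : Type) (f : V -> W -> R)
    (calA : set (set V)) (calB : set (set W))
    (mu : set V -> R) (nu : set W -> R) (delta gamma : R)
    (Vs : set V) (Ws : set W) : Prop :=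
  [/\ calA Vs, calB Ws &
    exists (V' : set V) (W' : set W),
    [/\ [/\ V' `<=` Vs, calA V' & mu V' >= (1 - gamma) * mu Vs],
        [/\ W' `<=` Ws, calB W' & nu W' >= (1 - gamma) * nu Ws],
        (exists r : R, 0 <= r <= 1 /\ forall b, W' b ->
           mu [set a | Vs a /\ `|f a b - r| <= delta] >= (1 - gamma) * mu Vs) &
        (exists s : R, 0 <= s <= 1 /\ forall a, V' a ->
           nu [set b | Ws b /\ `|f a b - s| <= delta] >= (1 - gamma) * nu Ws)]].

(* [A 0, ..., A m] partition the whole type; blocks may be empty. *)
Definition disjoint_cover (X : Type) (m : nat) (A : nat -> set X) : Prop :=
  trivIset `I_m.+1 A /\ \bigcup_(i in `I_m.+1) A i = setT.

(* Main.v *)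
(* The error bound splits as 3/2 Delta + delta with Delta = 5/2 delta, from two
   facts about the space of local types.
   First, every compact set of types of positive measure contains one, still of
   positive measure, on which the types differ by at most Delta at every
   parameter and are controlled by finitely many object tuples F: two
   parameters that look alike (up to theta) to F get values within
   theta + 2 delta.  If no F worked, then by compactness one could choose
   inductively a decreasing chain of compact sets of positive measure,
   parameters b_n, b'_n that look alike to a_0, ..., a_(n-1) but are more than
   theta + 2 delta apart for all types in the n-th set, and a_n realizing one of
   these types on all parameters chosen so far.  For i < j, stability then fails
   by delta for (a, b) or for (a, b'), and by Ramsey's theorem it is always the
   same one along a subsequence.  The diameter bound follows by pigeonhole, the
   parameters falling into finitely many classes with respect to F.
   Second, an exhaustion argument covers almost everything by finitely many
   disjoint such pieces, which can be enlarged to disjoint zerosets at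
   arbitrarily small relative cost.  For a piece C on one side and the subset W'
   of the zeroset on the other side on which the control set F of C varies by at
   most Delta, any p in C has values on W' in an interval of length
   Delta + 2 delta, so all of C has values on W' within
   Delta + (Delta + 2 delta) / 2 of its midpoint. *)
Require Import Defs.
From mathcomp Require Import all_boot all_order all_algebra.
From mathcomp Require Import all_classical all_reals all_analysis.
From mathcomp Require Import lra.

Set Implicit Arguments.
Unset Strict Implicit.
Unset Printing Implicit Defensive.

Import Order.TTheory GRing.Theory Num.Theory.
Import numFieldTopology.Exports.
Local Open Scope classical_set_scope.
Local Open Scope ring_scope.

(** * Substitution in formulas and realization of types on finitely many parameters *)

Section Substitution.
Context {R : realType} {L : language R}.

Fixpoint tsubst (V W : Type) (vs : V -> lsort L) (ws : W -> lsort L)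
    (sg : forall v, term ws (vs v)) (s : lsort L) (t : term vs s) : term ws s :=
  match t with
  | Var v => sg v
  | App f t => App (fun i => tsubst sg (t i))
  end.

Lemma teval_tsubst (M : structure L) (V W : Type) (vs : V -> lsort L)
    (ws : W -> lsort L) (sg : forall v, term ws (vs v)) s (t : term vs s)
    (a : tup M ws) :
  teval (tsubst sg t) a = teval t (fun v => teval (sg v) a).
Proof.
elim: t => //= f t IH; congr (fint _ _ _); apply: functional_extensionality_dep => i.
exact: IH.
Qed.

Definition lift_subst (V W : Type) (vs : V -> lsort L) (ws : W -> lsort L)
    (bs cs : seq (lsort L)) (s : lsort L)
    (sg : forall v, term (@vsort R L W ws cs) (@vsort R L V vs bs v)) :
  forall v, term (@vsort R L W ws (s :: cs)) (@vsort R L V vs (s :: bs) v) :=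
  fun o => match o return term (@vsort R L W ws (s :: cs)) (@vsort R L V vs (s :: bs) o) with
  | Some v => @tsubst _ _ (@vsort R L W ws cs) (@vsort R L W ws (s :: cs))
      (fun u => @Var R L _ (@vsort R L W ws (s :: cs)) (Some u)) _ (sg v)
  | None => @Var R L _ (@vsort R L W ws (s :: cs)) None
  end.

(** The stacks [bs] and [cs] are independent, so that a free variable can be turned into a bound
    one, as [inf_var] does. *)
Fixpoint fsubst (V W : Type) (vs : V -> lsort L) (ws : W -> lsort L)
    (bs : seq (lsort L)) (psi : bformula vs bs) : forall (cs : seq (lsort L)),
    (forall v, term (@vsort R L W ws cs) (@vsort R L V vs bs v)) ->
    bformula ws cs :=
  match psi in bformula _ bs return forall (cs : seq (lsort L)),
    (forall v, term (@vsort R L W ws cs) (@vsort R L V vs bs v)) ->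
    bformula ws cs with
  | Dist _ _ t u => fun cs sg => Dist (tsubst sg t) (tsubst sg u)
  | Pred _ P t => fun cs sg => Pred (fun i => tsubst sg (t i))
  | Conn _ _ u cu psi => fun cs sg => Conn cu (fun i => fsubst (psi i) sg)
  | Sup _ s psi => fun cs sg => Sup (fsubst psi (lift_subst (s:=s) sg))
  | Inf _ s psi => fun cs sg => Inf (fsubst psi (lift_subst (s:=s) sg))
  end.

Lemma pusht_lift_subst (M : structure L) (V W : Type) (vs : V -> lsort L)
    (ws : W -> lsort L) (bs cs : seq (lsort L)) (s : lsort L)
    (sg : forall v, term (@vsort R L W ws cs) (@vsort R L V vs bs v))
    (a : tup M (@vsort R L W ws cs)) (c : car M s) :
  (fun v => teval (lift_subst (s:=s) sg v) (pusht a c)) =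
  pusht (fun v => teval (sg v) a) c.
Proof.
apply: functional_extensionality_dep => -[v|] //=.
by rewrite teval_tsubst.
Qed.

Lemma beval_fsubst (M : structure L) (V W : Type) (vs : V -> lsort L)
    (ws : W -> lsort L) (bs : seq (lsort L)) (psi : bformula vs bs)
    (cs : seq (lsort L))
    (sg : forall v, term (@vsort R L W ws cs) (@vsort R L V vs bs v))
    (a : tup M (@vsort R L W ws cs)) :
  beval (fsubst psi sg) a = beval psi (fun v => teval (sg v) a).
Proof.
elim: psi cs sg a => {bs} /=.
- by move=> bs s t u cs sg a; rewrite !teval_tsubst.
- move=> bs P t cs sg a; congr (pint _ _ _).
  by apply: functional_extensionality_dep => i; rewrite teval_tsubst.
- move=> bs n u cu psi IH cs sg a; congr (u _).
  by apply/rowP => i; rewrite !mxE IH.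
- move=> bs s psi IH cs sg a; congr (sup _); apply: eq_imagel => c _.
  by rewrite IH pusht_lift_subst.
- move=> bs s psi IH cs sg a; congr (inf _); apply: eq_imagel => c _.
  by rewrite IH pusht_lift_subst.
Qed.

(** [swapb] acts on interpretations only; this is a formula that has the exchanged interpretation,
    so that saturation can be applied to it. *)
Definition swap_formula (x y : finType) (xs : x -> lsort L) (ys : y -> lsort L)
    (phi : formula (joinv xs ys)) : formula (joinv ys xs) :=
  @fsubst _ _ (joinv xs ys) (joinv ys xs) [::] phi [::]
    (fun u => match u return term (joinv ys xs) (joinv xs ys u) with
              | inl v => @Var R L _ (joinv ys xs) (inr v)
              | inr w => @Var R L _ (joinv ys xs) (inl w)
              end).

Lemma interp_swap (x y : finType) (xs : x -> lsort L) (ys : y -> lsort L)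
    (phi : formula (joinv xs ys)) (N : structure L) a b :
  interp (swap_formula phi) N b a = interp phi N a b.
Proof.
rewrite /interp /feval /swap_formula beval_fsubst; congr (beval _ _).
by apply: functional_extensionality_dep => -[v|w].
Qed.

(** The result keeps [v] in its context without depending on its value, so that iterating over a
    list of variables does not change the type. *)
Definition inf_var (V : finType) (vs : V -> lsort L) (v : V)
    (psi : formula vs) : formula vs :=
  Inf (@fsubst _ _ vs vs [::] psi [:: vs v]
    (@eqtype.dfwith V (fun u => term (@vsort R L V vs [:: vs v]) (vs u))
       (fun u => @Var R L _ (@vsort R L V vs [:: vs v]) (Some u)) v
       (@Var R L _ (@vsort R L V vs [:: vs v]) None))).

Lemma feval_inf_var (M : structure L) (V : finType) (vs : V -> lsort L) (v : V)
    (psi : formula vs) (a : tup M vs) :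
  feval (inf_var v psi) a =
  inf [set feval psi (@eqtype.dfwith V (fun u => car M (vs u)) a v c) | c in setT].
Proof.
rewrite /feval /=; congr (inf _); apply: eq_imagel => c _.
rewrite beval_fsubst; congr (beval _ _).
apply: functional_extensionality_dep => u.
case: (eqtype.dfwithP (fun u => @Var R L _ (@vsort R L V vs [:: vs v]) (Some u))
         (@Var R L _ (@vsort R L V vs [:: vs v]) None) u) => [|j vj] /=.
  by rewrite dfwith_in.
by rewrite dfwith_out.
Qed.

Definition inf_vars (V : finType) (vs : V -> lsort L) (l : seq V)
    (psi : formula vs) : formula vs := foldr (@inf_var V vs) psi l.

Section InfVars.
Variables (V : finType) (vs : V -> lsort L) (psi : formula vs).
Variables (M : structure L) (psi_ge0 : forall a : tup M vs, 0 <= feval psi a).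

Lemma inf_vars_ge0 l (a : tup M vs) : 0 <= feval (inf_vars l psi) a.
Proof.
elim: l a => [|v l IH] a //=; rewrite feval_inf_var.
apply: lb_le_inf; last by move=> _ [c _ <-].
by case: (car_nonempty M (vs v)) => c; eexists; exists c.
Qed.

(** Nonnegativity bounds the values from below, so that [inf] really is below each of them. *)
Lemma inf_vars_le l (a a' : tup M vs) :
  (forall v, v \notin l -> a' v = a v) ->
  feval (inf_vars l psi) a <= feval psi a'.
Proof.
elim: l a => [|v l IH] a aa'.
  by rewrite (_ : a = a') //; apply: functional_extensionality_dep => v; rewrite aa'.
rewrite /= feval_inf_var; pose a2 := @eqtype.dfwith V (fun u => car M (vs u)) a v (a' v).
apply: (@le_trans _ _ (feval (inf_vars l psi) a2)).
  apply: ge_inf; last by exists (a' v).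
  by exists 0 => _ [c _ <-]; apply: inf_vars_ge0.
apply: IH => u ul; rewrite /a2.
have [->|uv] := eqVneq u v; first by rewrite dfwith_in.
by rewrite dfwith_out 1?eq_sym// aa'// inE negb_or uv.
Qed.

Lemma inf_vars_lt l (a : tup M vs) e : feval (inf_vars l psi) a < e ->
  exists2 a', (forall v, v \notin l -> a' v = a v) & feval psi a' < e.
Proof.
elim: l a => [|v l IH] a; first by exists a.
rewrite /= feval_inf_var => /inf_lt [|_ [c _ <-] /IH[a' aa' lte]].
  by case: (car_nonempty M (vs v)) => c; eexists; exists c.
exists a' => // u; rewrite inE negb_or => /andP[uv ul].
by rewrite aa'// dfwith_out // eq_sym.
Qed.

End InfVars.

(** Cutting off at 0 expresses that the values are within total distance [e] of [r] as a condition
    of the form [psi = 0]. *)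
Lemma continuous_sum_dist_cut n (r : 'I_n -> R) (e : R) :
  continuous (fun t : 'rV[R]_n => Num.max (\sum_i `|t 0 i - r i| - e) 0).
Proof.
pose g (t : 'rV[R]_n) : R^o := \sum_i `|t 0 i - r i| - e.
move=> t; apply: (@continuous_max R _ g (cst 0) t); last exact: cst_continuous.
rewrite /g; apply: (@continuousB R R^o _ _ (cst e)); last exact: cst_continuous.
have: continuous (fun t : 'rV[R]_n => \sum_i (`|t 0 i - r i| : R^o)).
  apply: continuous_big => [|i _]; first exact: (@add_continuous R^o).
  move=> u; apply: (@cvg_norm R R^o _ _ (nbhs_filter u)).
  by apply: (@continuousB R R^o) => //; [exact: coord_continuous|exact: cst_continuous].
exact.
Qed.

(* Elementarity alone gives approximate realizations in [M]; saturation is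
   what makes the agreement exact. *)
Lemma finitely_realized (x y : finType) (xs : x -> lsort L) (ys : y -> lsort L)
    (phi : formula (joinv xs ys)) (M N : structure L)
    (h : forall s, car M s -> car N s) (a : tup N xs) n
    (b : 'I_n -> tup M ys) :
  omega_saturated M -> elementary h ->
  exists a0 : tup M xs, forall i,
    interp phi M a0 (b i) = interp phi N a (fun v => h _ (b i v)).
Proof.
move=> satM elemh.
(* Saturation takes a single parameter tuple, so the [b i] are merged into one, indexed by pairs. *)
pose ps (q : 'I_n * y) := ys q.2.
pose phi_ (i : 'I_n) : formula (joinv xs ps) :=
  @fsubst _ _ (joinv xs ys) (joinv xs ps) [::] phi [::]
    (fun u => match u return term (joinv xs ps) (joinv xs ys u) with
              | inl v => @Var R L _ (joinv xs ps) (inl v)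
              | inr w => @Var R L _ (joinv xs ps) (inr (i, w))
              end).
have phi_E (P : structure L) (c : tup P (joinv xs ps)) i :
    feval (phi_ i) c =
    interp phi P (fun v => c (inl v)) (fun w => c (inr (i, w))).
  rewrite /interp /feval /phi_ beval_fsubst; congr (beval _ _).
  by apply: functional_extensionality_dep => -[v|w].
pose r i := interp phi N a (fun v => h _ (b i v)).
pose chi e : formula (joinv xs ps) := Conn (@continuous_sum_dist_cut n r e) phi_.
pose dist (P : structure L) (c : tup P (joinv xs ps)) :=
  \sum_i `|interp phi P (fun v => c (inl v)) (fun w => c (inr (i, w))) - r i|.
have chiE e P (c : tup P (joinv xs ps)) :
    feval (chi e) c = Num.max (dist P c - e) 0.
  rewrite /feval /=; congr (Num.max (_ - _) _); apply: eq_bigr => i _.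
  by rewrite mxE -phi_E.
have chi_ge0 e P (c : tup P (joinv xs ps)) : 0 <= feval (chi e) c.
  by rewrite chiE le_max lexx orbT.
pose c0 : tup M ps := fun q => b q.1 q.2.
pose l : seq (x + 'I_n * y) := [seq inl v | v <- enum x].
have approx e : 0 < e -> exists a' : tup M xs, dist M (joint a' c0) < e.
  move=> e0; pose d := joint (@some_tup R L x xs M) c0.
  (* In [N] the tuple [a] makes the infimum over the object variables vanish, and elementarity
     brings this back to [M]. The object entries of [d] are arbitrary, since [l] lists all of
     them. *)
  have : feval (inf_vars l (chi 0)) d < e.
    rewrite -(elemh _ _ _ d); apply: le_lt_trans e0.
    apply: (@le_trans _ _ (feval (chi 0) (joint a (fun q => h _ (c0 q))))).
      apply: inf_vars_le => // -[v|q] //=.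
      by rewrite map_f ?mem_enum.
    rewrite chiE ge_max lexx andbT subr0 /dist big1// => i _.
    by apply/eqP; rewrite normr_eq0 subr_eq0.
  case/inf_vars_lt => a' aa'.
  rewrite chiE subr0 gt_max => /andP[lte _]; exists (fun v => a' (inl v)).
  rewrite (_ : joint _ _ = a')//.
  apply: functional_extensionality_dep => -[v|q] //=; rewrite aa'//.
  by apply/mapP => -[].
(* In a finite part of [G] the condition with the largest index implies the others; a solution of
   all of [G] has distance 0. *)
pose G : set (formula (joinv xs ps)) := [set chi k.+1%:R^-1 | k in setT].
have [F finF FG|a0 a0G] := satM _ _ ps xs c0 G.
  have [K FK] : exists K, forall psi, F psi ->
      exists2 k, (k <= K)%N & psi = chi k.+1%:R^-1.
    have : forall psi, exists k, F psi -> psi = chi k.+1%:R^-1.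
      move=> psi; have [/FG[k _ <-]|] := pselect (F psi); first by exists k.
      by move=> nF; exists 0%N.
    case/choice => k kP.
    have [K Kub] : exists K, forall j, (k @` F) j -> (j <= K)%N.
      case/finite_seqP: (finite_image k finF) => s ->.
      exists (\max_(j <- s) j)%N => j /= js.
      by apply: (@leq_bigmax_seq _ _ xpredT id).
    exists K => psi Fpsi; exists (k psi); last exact: kP.
    by apply: Kub; exists psi.
  have [a' a'P] := approx K.+1%:R^-1 ltac:(by rewrite invr_gt0 ltr0n).
  exists a' => psi /FK[k kK ->]; rewrite chiE.
  apply/max_idPr; rewrite subr_le0; apply/ltW/(lt_le_trans a'P).
  by rewrite lef_pV2 ?posrE ?ltr0n// ler_nat.
exists a0 => i.
have d0 : dist M (joint a0 c0) <= 0.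
  apply/ler_addgt0Pr => e e0; rewrite add0r.
  have [k ke] : exists k, k.+1%:R^-1 < e.
    exists (Num.truncn e^-1); rewrite invf_plt ?posrE ?ltr0n//.
    by rewrite truncnS_gt.
  have := a0G (chi k.+1%:R^-1) ltac:(by exists k).
  rewrite chiE => /eqP; rewrite eq_le ge_max lexx andbT => /andP[+ _].
  by rewrite subr_le0 => /le_trans; apply; exact: ltW.
apply/eqP; rewrite -subr_eq0 -normr_le0; apply: le_trans d0.
rewrite /dist (bigD1 i)//= lerDl; exact: sumr_ge0.
Qed.

End Substitution.

(** * Tools from combinatorics, compactness and the unit interval *)

(** Dependent choice on histories: the state is the newest element with the list of its
    predecessors, and each new element is chosen compatible with all of them. *)
Lemma pairwise_choice (T : choiceType) (U : T -> Prop) (r : T -> T -> Prop) :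
  (exists t, U t) ->
  (forall t s, U t -> {in s, forall u, r u t} ->
     exists t', U t' /\ {in t :: s, forall u, r u t'}) ->
  exists g : nat -> T, (forall n, U (g n)) /\ forall i j, (i < j)%N -> r (g i) (g j).
Proof.
case=> t0 Ut0 step.
pose good (h : T * seq T) := U h.1 /\ {in h.2, forall u, r u h.1}.
have next h : exists t', good h -> good (t', h.1 :: h.2).
  have [[Uh rh]|?] := pselect (good h); last by exists t0.
  by have [t' ?] := step _ _ Uh rh; exists t'.
have [nx nxP] := choice next.
pose H n := iter n (fun h => (nx h, h.1 :: h.2)) (t0, [::]).
have goodH n : good (H n) by elim: n => //= n; apply: nxP.
exists (fun n => (H n).1); split=> [n|i j ij]; first by case: (goodH n).
have [_ +] := goodH j; apply.
elim: j ij => // j IH; rewrite ltnS leq_eqVlt => /predU1P[->|/IH] /=.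
  exact: mem_head.
by rewrite inE => ->; rewrite orbT.
Qed.

(** Let [G] be a nonprincipal ultrafilter. For [G]-most [i] the same alternative, [P i j] or its
    negation, holds for [G]-most [j]; a subsequence is then chosen greedily, as finitely many large
    sets always meet. *)
Lemma ramsey_pairs (P : nat -> nat -> Prop) : exists g : nat -> nat,
  (forall i j, (i < j)%N -> (g i < g j)%N) /\
  ((forall i j, (i < j)%N -> P (g i) (g j)) \/
   (forall i j, (i < j)%N -> ~ P (g i) (g j))).
Proof.
have [G [GU infG]] := @ultraFilterLemma nat \oo _.
have gtG i : G [set j | (i < j)%N] by apply: infG; exact: nbhs_infty_gt.
have sub (Q : nat -> nat -> Prop) : G [set i | G [set j | Q i j]] ->
    exists g : nat -> nat, forall i j, (i < j)%N -> (g i < g j)%N /\ Q (g i) (g j).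
  set S := [set i | _] => GS.
  (* The conjunct [S i] records that every element of the history has a large set of admissible
     successors. *)
  have [] := @pairwise_choice nat S (fun i j => S i /\ (i < j)%N /\ Q i j).
  - exact: (filter_ex GS).
  - move=> t s St rst.
    have : G (S `&` [set j | {in t :: s, forall u, (u < j)%N /\ Q u j}]).
      apply: filterI => //.
      have : {in t :: s, forall u, S u}.
        by move=> u; rewrite inE => /predU1P[->//|/rst[]].
      elim: (t :: s) => [_|u l IH Sl].
        by apply: (filterS _ filterT) => j _ u; rewrite in_nil.
      apply: filterS (filterI (IH _) (filterI (gtG u) (Sl u (mem_head _ _)))).
        by move=> j [/= Hl Hu] v; rewrite inE => /predU1P[->//|/Hl].
      by move=> v vl; apply: Sl; rewrite inE vl orbT.
    case/filter_ex => t' [St' Ht']; exists t'; split => // u us.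
    split; last exact: Ht'.
    by move: us; rewrite inE => /predU1P[->//|/rst[]].
  - by move=> g [_ gP]; exists g => i j /gP[].
have [/sub[g gP]|GC] := in_ultra_setVsetC [set i | G [set j | P i j]] GU.
  by exists g; split=> [i j /gP[]//|]; left=> i j /gP[].
have [|g gP] := sub (fun i j => ~ P i j).
  by apply: filterS GC => i /= nG; case: (in_ultra_setVsetC [set j | P i j] GU).
by exists g; split=> [i j /gP[]//|]; right=> i j /gP[].
Qed.

(** Otherwise the sets whose complement in [K] lies in the ideal [I] form a proper filter. A cluster
    point of it in [K] would have a neighbourhood in [I], whose complement belongs to the filter. *)
Lemma compact_ideal (T : topologicalType) (K : set T) (I : set T -> Prop) :
  compact K -> I set0 -> (forall X Y, I X -> I Y -> I (X `|` Y)) ->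
  (forall X Y, X `<=` Y -> I Y -> I X) ->
  (forall q, K q -> exists2 U, open_nbhs q U & I U) -> I K.
Proof.
move=> cK I0 IU IS IK; apply: contrapT => nIK.
pose F : set_system T := [set X | I (K `&` ~` X)].
have FF : ProperFilter F.
  split; first by rewrite /F /= setC0 setIT.
  split; rewrite /F /=.
  - by rewrite setCT setI0.
  - by move=> X Y IX IY; apply: IS (IU _ _ IX IY); rewrite -setIUr -setCI.
  - by move=> X Y XY; apply: IS; apply: setIS; exact: subsetC.
have [|q [Kq clq]] := cK F FF; first by rewrite /F /= setICr.
have [U oU IU'] := IK q Kq.
have [] := clq (~` U) U; last by move=> z [].
  by rewrite /F /= setCK; apply: IS IU' => z [].
exact: open_nbhs_nbhs.
Qed.

(** The midpoint of [inf S] and [sup S] works, with 0 for empty [S]. Halving the diameter here is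
    what keeps the final error below [5 * delta]. *)
Lemma midrange (R : realType) (S : set R) (d : R) :
  (forall u, S u -> 0 <= u <= 1) -> (forall u v, S u -> S v -> `|u - v| <= d) ->
  exists2 r, 0 <= r <= 1 & forall u, S u -> `|u - r| <= d / 2.
Proof.
move=> S01 Sd; have [[u0 Su0]|S0] := pselect (S !=set0); last first.
  exists 0; first by rewrite lexx ler01.
  by move=> u Su; case: S0; exists u.
have ubS : has_sup S by split; [exists u0|exists 1 => u /S01/andP[]].
have lbS : has_inf S by split; [exists u0|exists 0 => u /S01/andP[]].
have ub1 : sup S <= 1 by apply: ge_sup; [exists u0|move=> u /S01/andP[]].
have lb0 : 0 <= inf S by apply: lb_le_inf; [exists u0|move=> u /S01/andP[]].
have le_sup u : S u -> u <= sup S by move=> Su; apply: ub_le_sup => //; case: ubS.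
have inf_le u : S u -> inf S <= u by move=> Su; apply: ge_inf => //; case: lbS.
have gap : sup S <= inf S + d.
  apply: ge_sup; first by exists u0.
  move=> u Su; rewrite -lerBlDr; apply: lb_le_inf; first by exists u0.
  by move=> v Sv; move: (Sd u v Su Sv); rewrite ler_norml => /andP[]; lra.
have := le_sup _ Su0; have := inf_le _ Su0.
exists ((sup S + inf S) / 2); first lra.
move=> u Su; have := le_sup _ Su; have := inf_le _ Su.
by rewrite ler_norml; lra.
Qed.

Lemma unit_grid (R : realType) N (t : R) : 0 <= t <= 1 ->
  exists2 k, (k < N.+2)%N & `|t - k%:R / N.+1%:R| <= N.+1%:R^-1.
Proof.
move=> /andP[t0 t1]; have N0 : 0 < N.+1%:R :> R by rewrite ltr0n.
have t0N : 0 <= t * N.+1%:R by rewrite mulr_ge0// ltW.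
exists (Num.truncn (t * N.+1%:R)).
  rewrite ltnS -(@ler_nat R); apply: (@le_trans _ _ (t * N.+1%:R)).
    by rewrite truncn_le.
  by rewrite ler_piMl// ltW.
have /andP[] := truncn_itv t0N; set k := Num.truncn _ => kt tk.
rewrite -[X in X - _](mulfK (lt0r_neq0 N0)) -mulrBl normrM ger0_norm ?subr_ge0//.
rewrite gtr0_norm ?invr_gt0// ler_piMl ?invr_ge0 ?(ltW N0)//.
by rewrite lerBlDl natr1 ltW.
Qed.

Lemma closed_distr_le (R : realType) (c d : R) : closed [set z : R | `|z - c| <= d].
Proof.
rewrite (_ : [set z | _] = `[c - d, c + d]%classic); first exact: interval_closed.
by apply/seteqP; split=> z; rewrite /= in_itv/= ler_distl.
Qed.

(** * Inner regular probability measures on a Hausdorff space *)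

Section RegularProbability.
Context {R : realType} {T : ptopologicalType}.
Variable mu : probability (g_sigma_algebraType (@open T)) R.
Hypothesis hausT : hausdorff_space T.
Hypothesis mu_inner : forall X, <<s @open T >> X ->
  mu X = ereal_sup [set mu K | K in [set K | compact K /\ K `<=` X]].

Definition fine_mass (X : set T) : R := fine (mu X).

Local Notation borel := (<<s @open T >>).

Lemma open_borel (X : set T) : open X -> borel X.
Proof. exact: sub_sigma_algebra. Qed.

Lemma borelC (X : set T) : borel X -> borel (~` X).
Proof. exact: (@measurableC _ (g_sigma_algebraType (@open T))). Qed.

Lemma borelU (X Y : set T) : borel X -> borel Y -> borel (X `|` Y).
Proof. exact: (@measurableU _ (g_sigma_algebraType (@open T))). Qed.

Lemma borelI (X Y : set T) : borel X -> borel Y -> borel (X `&` Y).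
Proof. exact: (@measurableI _ (g_sigma_algebraType (@open T))). Qed.

Lemma borelD (X Y : set T) : borel X -> borel Y -> borel (X `\` Y).
Proof. exact: (@measurableD _ (g_sigma_algebraType (@open T))). Qed.

Lemma closed_borel (X : set T) : closed X -> borel X.
Proof. by move=> /closed_openC/open_borel/borelC; rewrite setCK. Qed.

Lemma compact_borel (X : set T) : compact X -> borel X.
Proof. by move/(compact_closed hausT)/closed_borel. Qed.

Lemma massE (X : set T) : borel X -> mu X = (fine_mass X)%:E.
Proof. by move=> mX; rewrite /fine_mass fineK// fin_num_measure. Qed.

Lemma mass_ge0 (X : set T) : 0 <= fine_mass X.
Proof. exact: fine_ge0. Qed.

Lemma mass_le (X Y : set T) : borel X -> borel Y -> X `<=` Y -> fine_mass X <= fine_mass Y.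
Proof.
by move=> mX mY XY; rewrite -lee_fin -!massE//; apply: le_measure; rewrite ?inE.
Qed.

Lemma massU (X Y : set T) : borel X -> borel Y -> X `&` Y = set0 ->
  fine_mass (X `|` Y) = fine_mass X + fine_mass Y.
Proof.
move=> mX mY XY0; apply: EFin_inj; rewrite -massE; last exact: borelU.
by rewrite measureU// EFinD -!massE.
Qed.

Lemma massID (X Y : set T) : borel X -> borel Y ->
  fine_mass X = fine_mass (X `&` Y) + fine_mass (X `\` Y).
Proof.
move=> mX mY; rewrite -massU ?setUIDK//; [exact: borelI|exact: borelD|].
by rewrite -subset0 => z [[_ ?] []].
Qed.

Lemma massC (X : set T) : borel X -> fine_mass (~` X) = 1 - fine_mass X.
Proof.
move=> mX; apply: EFin_inj; rewrite -massE; last exact: borelC.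
by rewrite probability_setC// EFinB -massE.
Qed.

Lemma mass_le1 (X : set T) : borel X -> fine_mass X <= 1.
Proof. by move=> mX; rewrite -lee_fin -massE// probability_le1. Qed.

Lemma inner_compact (X : set T) e : borel X -> 0 < e ->
  exists K, [/\ compact K, K `<=` X & fine_mass X - e < fine_mass K].
Proof.
move=> mX e0.
have : ((fine_mass X - e)%:E < mu X)%E by rewrite massE// lte_fin ltrBlDr ltrDl.
rewrite mu_inner// => /ereal_sup_gt[_ [K [cK KX] <-]].
by rewrite (massE (compact_borel cK)) lte_fin => ?; exists K.
Qed.

Lemma inner_compact_gt0 (X : set T) : borel X -> 0 < fine_mass X ->
  exists K, [/\ compact K, K `<=` X & 0 < fine_mass K].
Proof.
move=> mX X0; have [K [cK KX lt]] := inner_compact mX X0.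
by exists K; split => //; rewrite subrr in lt.
Qed.

(** Sets with null trace on [K] form an ideal; if every such [U] had null trace, compactness would
    make [K] itself null. *)
Lemma mass_open_cover (K : set T) (Q : set T -> Prop) :
  compact K -> 0 < fine_mass K -> (forall q, K q -> exists2 U, open_nbhs q U & Q U) ->
  exists U, [/\ open U, Q U & 0 < fine_mass (K `&` U)].
Proof.
move=> cK K0 cov; have mK := compact_borel cK; apply: contrapT => nU.
suff : mu.-negligible (K `&` K).
  rewrite setIid => /(negligibleP mu (mK : measurable (K : set (g_sigma_algebraType _)))).
  move=> muK0; move: K0; rewrite /fine_mass (_ : mu K = 0%E) ?ltxx//.
apply: (@compact_ideal T K (fun X => mu.-negligible (K `&` X)) cK).
- rewrite setI0; exact: negligible_set0.
- by move=> X Y; rewrite setIUr; exact: negligibleU.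
- by move=> X Y XY; apply: negligibleS; exact: setIS.
- move=> q /cov[U [oU Uq] QU]; exists U => //.
  have mKU : borel (K `&` U) by apply: borelI => //; exact: open_borel.
  apply/(negligibleP mu (mKU : measurable (_ : set (g_sigma_algebraType _)))).
  rewrite [LHS]massE//; congr EFin; apply/eqP; rewrite eq_le mass_ge0 andbT leNgt.
  by apply/negP => KU0; apply: nU; exists U.
Qed.

(** Pigeonhole by induction: if the last set has null trace on [K], removing it costs no mass. *)
Lemma mass_closed_cover (K : set T) n (C : nat -> set T) :
  borel K -> 0 < fine_mass K -> (forall k, closed (C k)) ->
  (forall q, K q -> exists2 k, (k < n)%N & C k q) ->
  exists2 k, (k < n)%N & 0 < fine_mass (K `&` C k).
Proof.
elim: n K => [|n IH] K mK K0 cC cov.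
  have /negP[] := lt_geF K0; rewrite leNgt; apply/negP => _.
  have K00 : K = set0 by rewrite -subset0 => q /cov[].
  by move: K0; rewrite K00 /fine_mass measure0 ltxx.
have [?|] := ltP 0 (fine_mass (K `&` C n)); first by exists n.
move=> n0; have mC := closed_borel (cC n); have E := massID mK mC.
have [|||q [Kq nCq]|k kn] := IH (K `\` C n) => //; [exact: borelD|lra| |].
  have [k] := cov q Kq; rewrite ltnS leq_eqVlt => /predU1P[->//|? ?].
  by exists k.
move=> gt0; exists k; first exact: ltnW.
apply: (lt_le_trans gt0); have mk := closed_borel (cC k).
by apply: mass_le; [do 2!apply: borelI => //; exact: borelC|exact: borelI|move=> q [[]]].
Qed.

End RegularProbability.

(** * Topology and algebra of the space of local types *)

Section LocalTypeSpace.
Context {R : realType} {L : language R} {x y : finType}.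
Context {xs : x -> lsort L} {ys : y -> lsort L}.
Variables (Phi : bpred xs ys) (M : structure L).

Local Notation S := (local_type Phi M).
Local Notation f := (@Phi M).

Lemma type_val_continuous b : continuous (fun p : S => type_val p b).
Proof.
move=> p; apply: (@continuous_comp _ _ _ (fun p : S => (\val p : {ptws (tup M ys) -> R}))
  (fun g : {ptws (tup M ys) -> R} => g b)).
  exact: initial_continuous.
exact: (@proj_continuous _ (fun=> R) b).
Qed.

Lemma type_val_inj (p q : S) : (forall b, type_val p b = type_val q b) -> p = q.
Proof. by move=> pq; apply: val_inj; apply/funext => b; exact: pq. Qed.

Lemma closed_type_val b (D : set R) : closed D -> closed [set p : S | D (type_val p b)].
Proof. by move=> cD; apply: closed_comp => // p _; exact: type_val_continuous. Qed.

Lemma open_type_val b (D : set R) : open D -> open [set p : S | D (type_val p b)].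
Proof. by move=> oD; apply: open_comp => // p _; exact: type_val_continuous. Qed.

(** Two thresholds [t < u] rather than one: the open half-lines give the Hausdorff property, and the
    closed ones stay disjoint, as the separation by zerosets requires. *)
Lemma type_val_separates (p q : S) : p <> q ->
  exists b t u, t < u /\ ((type_val p b < t /\ u < type_val q b) \/
                          (type_val q b < t /\ u < type_val p b)).
Proof.
move=> pq; have [b /eqP] : exists b, type_val p b <> type_val q b.
  apply: contrapT => nb; apply: pq; apply: type_val_inj => b.
  by apply: contrapT => ?; apply: nb; exists b.
set u := type_val p b; set v := type_val q b; rewrite neq_lt => /orP[uv|vu].
  by exists b, ((2 * u + v) / 3), ((u + 2 * v) / 3); split; [lra|left; rewrite -/u -/v; lra].
by exists b, ((2 * v + u) / 3), ((v + 2 * u) / 3); split; [lra|right; rewrite -/u -/v; lra].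
Qed.

Lemma local_type_hausdorff : hausdorff_space S.
Proof.
rewrite open_hausdorff => p q /eqP/type_val_separates[b [t [u [tu sep]]]].
pose A := [set p : S | [set z : R | z < t] (type_val p b)].
pose B := [set p : S | [set z : R | u < z] (type_val p b)].
have oA : open A by apply: open_type_val; exact: open_lt.
have oB : open B by apply: open_type_val; exact: open_gt.
have AB : A `&` B = set0.
  by rewrite -subset0 => r []; rewrite /A /B /= => ? ?; lra.
case: sep => -[pt qt]; [exists (A, B)|exists (B, A)] => /=.
- by split; rewrite inE.
- by split => //; rewrite AB.
- by split; rewrite inE.
- by split => //; rewrite setIC AB.
Qed.

Hypothesis realized : forall (p : S) (s : seq (tup M ys)),
  exists a, {in s, forall b, f a b = type_val p b}.

(* Sets in the type algebra depend on finitely many parameters, so a type may be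
   replaced by a realized one. *)
Lemma type_set_preimage (Y : set S) :
  type_algebra Y -> type_set Phi (@tp _ _ _ _ _ _ Phi M @^-1` Y) = Y.
Proof.
pose fin_supp (Z : set S) := exists s : seq (tup M ys), forall p q : S,
  {in s, forall b, type_val p b = type_val q b} -> Z p -> Z q.
have supp : @type_algebra _ _ _ _ _ _ Phi M `<=` fin_supp.
  apply: smallest_sub; first split.
  - by exists [::].
  - move=> Z [s sZ]; exists s => p q pq nZ Zq; apply: nZ; apply: sZ Zq.
    by move=> b /pq.
  - move=> Z Z' [s sZ] [s' sZ']; exists (s ++ s') => p q pq [Zp|Zp].
      by left; apply: sZ Zp => b bs; apply: pq; rewrite mem_cat bs.
    by right; apply: sZ' Zp => b bs; apply: pq; rewrite mem_cat bs orbT.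
  - move=> Z [b [D [_ ->]]]; exists [:: b] => p q pq /=.
    by rewrite pq// mem_head.
move=> aY; rewrite /type_set; case: xgetP => [Z _ [aZ ZY]|/(_ Y)]; last first.
  by case.
have [s sY] := supp _ aY; have [s' sZ] := supp _ aZ.
apply/seteqP; split => p; have [a ap] := realized p (s ++ s') => Xp.
- have: (tp Phi a : S) \in Y.
    rewrite inE -[Y _]/((tp Phi (M := M) @^-1` Y) a) -ZY /=.
    by apply: sZ Xp => b bs; rewrite -ap // mem_cat bs orbT.
  by rewrite inE; apply: sY => b bs; rewrite -ap // mem_cat bs.
- have: (tp Phi a : S) \in Z.
    rewrite inE -[Z _]/((tp Phi (M := M) @^-1` Z) a) ZY /=.
    by apply: sY Xp => b bs; rewrite -ap // mem_cat bs.
  by rewrite inE; apply: sZ => b bs; rewrite -ap // mem_cat bs orbT.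
Qed.

End LocalTypeSpace.

(** * Compact pieces of small diameter controlled by finitely many objects *)

Section Pieces.
Context {R : realType} {L : language R} {x y : finType}.
Context {xs : x -> lsort L} {ys : y -> lsort L}.
Variables (Phi : bpred xs ys) (M : structure L) (delta : R).

Local Notation S := (local_type Phi M).
Local Notation f := (@Phi M).

Hypothesis f01 : forall a b, 0 <= f a b <= 1.
Hypothesis realized : forall (p : S) (s : seq (tup M ys)),
  exists a, {in s, forall b, f a b = type_val p b}.
Hypothesis stable_f : ~ exists (a : nat -> tup M xs) (b : nat -> tup M ys),
  forall i j, (i < j)%N -> delta <= `|f (a i) (b j) - f (a j) (b i)|.

Variable mu : probability (borel_local_type Phi M) R.
Hypothesis mu_inner : forall X, <<s @open S >> X ->
  mu X = ereal_sup [set mu K | K in [set K | compact K /\ K `<=` X]].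

Local Notation haus := (@local_type_hausdorff _ _ _ _ _ _ Phi M).
Local Notation mass := (fine_mass mu).
Local Notation cborel := (compact_borel haus).

(** For [delta <= 0] constant sequences would contradict stability. *)
Lemma delta_gt0 : 0 < delta.
Proof.
rewrite ltNge; apply/negP => d0; apply: stable_f.
exists (fun=> some_tup M), (fun=> some_tup M) => i j _.
exact: le_trans (normr_ge0 _).
Qed.

Lemma type_val01 (p : S) b : 0 <= type_val p b <= 1.
Proof. by have [a /(_ b (mem_head _ _)) <-] := realized p [:: b]. Qed.

Definition close_on (theta : R) (F : seq (tup M xs)) b b' :=
  {in F, forall a, `|f a b - f a b'| <= theta}.

Definition controlled_by (theta : R) (F : seq (tup M xs)) : set S :=
  [set p | forall b b', close_on theta F b b' ->
    `|type_val p b - type_val p b'| <= theta + 2 * delta].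

Lemma closed_controlled_by theta F : closed (controlled_by theta F).
Proof.
rewrite (_ : controlled_by _ _ =
  \bigcap_(bb in [set bb | close_on theta F bb.1 bb.2])
    [set p : S | `|type_val p bb.1 - type_val p bb.2| <= theta + 2 * delta]).
  apply: closed_bigI => -[b b'] _ /=.
  apply: (@closed_comp _ _ (fun p : S => `|type_val p b - type_val p b'|) [set z | z <= theta + 2 * delta]).
    move=> p _; apply: (@cvg_norm R R^o _ _ (nbhs_filter p)).
    by apply: (@continuousB R R^o) => //; exact: type_val_continuous.
  exact: closed_le.
by apply/seteqP; split=> [p H [b b'] /H|p H b b' /(H (b, b'))].
Qed.

Lemma controlled_piece (P : set S) (theta : R) :
    0 <= theta -> compact P -> 0 < mass P ->
  exists F, 0 < mass (P `&` controlled_by theta F).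
Proof.
move=> theta0 cP P0; apply: contrapT => /forallNP nF.
(* A stage of the construction: a compact set, an object tuple and a pair of parameters. *)
pose T : choiceType := (set S * tup M xs * (tup M ys * tup M ys))%type.
pose gap (p : S) (t : T) := type_val p t.2.1 - type_val p t.2.2.
pose D := theta + 2 * delta.
pose U (t : T) := [/\ compact t.1.1, 0 < mass t.1.1, t.1.1 `<=` P,
  forall p, t.1.1 p -> D < gap p t & f t.1.2 t.2.1 - f t.1.2 t.2.2 > D].
(* Here [u] is the earlier stage: its object hardly distinguishes the parameters of [t], while the
   object of [t] sees the full gap between the parameters of [u]. *)
pose r (u t : T) := [/\ U u, t.1.1 `<=` u.1.1,
  `|f u.1.2 t.2.1 - f u.1.2 t.2.2| <= theta &
  f t.1.2 u.2.1 - f t.1.2 u.2.2 > D].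
have step (K : set S) (s : seq T) : compact K -> 0 < mass K -> K `<=` P ->
    {in s, forall u, U u /\ K `<=` u.1.1} -> exists t, U t /\ {in s, forall u, r u t}.
  move=> cK K0 KP sK; pose F := [seq u.1.2 | u <- s].
  have mF := closed_borel (@closed_controlled_by theta F).
  have mK := cborel cK.
  (* By assumption the controlled part of [K] is null, so the rest carries all its mass. *)
  have [K1 [cK1 K1K K10]] : exists K1, [/\ compact K1,
      K1 `<=` K `\` controlled_by theta F & 0 < mass K1].
    apply: (inner_compact_gt0 haus mu_inner); first exact: borelD.
    have := massID mu mK mF; suff : mass (K `&` controlled_by theta F) <= 0 by lra.
    rewrite leNgt; apply/negP => KF0; apply: (nF F); apply: (lt_le_trans KF0).
    by apply: mass_le; [exact: borelI|apply: borelI => //; exact: cborel|exact: setSI].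
  have cov q : K1 q -> exists2 W, open_nbhs q W &
      exists b b', close_on theta F b b' /\
        W = [set p | D < type_val p b - type_val p b'].
    move=> /K1K[Kq] /existsNP[b /existsNP[b' /not_implyP[Fbb]]] /negP; rewrite -ltNge => gt.
    have oW c c' : open [set p : S | D < type_val p c - type_val p c'].
      apply: (@open_comp _ _ (fun p : S => type_val p c - type_val p c') [set z | D < z]).
        move=> p _.
        by apply: (@continuousB R R^o) => //; exact: type_val_continuous.
      exact: open_gt.
    (* Exchanging [b] and [b'] if necessary makes the gap positive. *)
    move: gt; rewrite ltr_normr => /orP[gt|]; last rewrite opprB => gt.
      by exists [set p | D < type_val p b - type_val p b'] => //; exists b, b'.
    exists [set p | D < type_val p b' - type_val p b] => //; exists b', b.
    by split => // a /Fbb; rewrite distrC.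
  have [W [oW [b [b' [bb' WE]]] W0]] := mass_open_cover haus cK1 K10 cov.
  have [|K2 [cK2 K2W K20]] := inner_compact_gt0 haus mu_inner _ W0.
    by apply: borelI; [exact: cborel|exact: open_borel].
  have [p K2p] : K2 !=set0.
    by apply/set0P/eqP => K2E; move: K20; rewrite K2E /fine_mass measure0 ltxx.
  (* The realization must match [p] on the new parameters and on those of all earlier stages. *)
  have [a ap] := realized p (b :: b' :: flatten [seq [:: u.2.1; u.2.2] | u <- s]).
  have K2D q : K2 q -> D < type_val q b - type_val q b'.
    by move=> /K2W[_]; rewrite WE.
  have K2K : K2 `<=` K by move=> q /K2W[/K1K[]].
  have Ut : U (K2, a, (b, b')).
    split => //=; first by move=> q /K2K/KP.
    by rewrite !ap ?inE ?eqxx ?orbT//; exact: K2D.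
  exists (K2, a, (b, b')); split => // u us; have [Uu Ku] := sK u us.
  split => //=; first by move=> q /K2K/Ku.
    by apply: bb'; apply: map_f.
  have us' c : c \in [:: u.2.1; u.2.2] ->
      c \in b :: b' :: flatten [seq [:: u.2.1; u.2.2] | u <- s].
    by move=> cu; rewrite !inE; apply/orP; right; apply/orP; right;
      apply/flatten_mapP; exists u.
  rewrite !ap; [|by apply: us'; rewrite !inE eqxx ?orbT..].
  by case: Uu => _ _ _ + _; apply; apply: Ku; apply: K2K.
have [||g [Ug rg]] := @pairwise_choice T U r.
- by have [||||t [Ut _]] := step P [::] => //; exists t.
- move=> t s Ut st; have [cK K0 KP _ _] := Ut.
  by apply: (step t.1.1) => // u; rewrite inE => /predU1P[->|/st[Uu tu _ _]]; split.
pose A n := (g n).1.2; pose b n := (g n).2.1; pose b' n := (g n).2.2.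
have [h [hlt [hP|hP]]] := ramsey_pairs
    (fun i j => delta <= `|f (A i) (b j) - f (A j) (b i)|).
  by apply: stable_f; exists (A \o h), (b \o h).
(* Replacing [b] by [b'] changes the first value by at most [theta] and lowers the second by more
   than [theta + 2 * delta]; a difference above [- delta] thus becomes one above [delta]. *)
apply: stable_f; exists (A \o h), (b' \o h) => i j ij /=.
have := hP _ _ ij; have [_ _] := rg _ _ (hlt _ _ ij).
rewrite -/(A _) -/(A _) -/(b _) -/(b _) -/(b' _) -/(b' _) => le1 lt2 /negP.
move: le1; rewrite ler_norml -ltNge ltr_norml ler_normr /D in lt2 * => le1 lt3.
by apply/orP; left; lra.
Qed.


(** The colour rounds every [f a b] with [a] in [F] to a grid point; two values with the same
    rounding are each within [N.+1%:R^-1] of it, whence the factor 2. *)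
Lemma close_coloring N (F : seq (tup M xs)) :
  exists (I : finType) (col : tup M ys -> I), forall b b', col b = col b' ->
    close_on (2 * N.+1%:R^-1) F b b'.
Proof.
elim: F => [|a F [I [col colP]]].
  by exists unit, (fun=> tt) => b b' _ a; rewrite in_nil.
have /choice[k kP] b : exists k, (k < N.+2)%N /\ `|f a b - k%:R / N.+1%:R| <= N.+1%:R^-1.
  by have [k] := unit_grid N (f01 a b); exists k.
exists (I * 'I_N.+2)%type, (fun b => (col b, inord (k b))) => b b' [/colP bb' kk] a'.
rewrite inE => /predU1P[->|]; last exact: bb'.
have [kb fb] := kP b; have [kb' fb'] := kP b'.
move/(congr1 (@nat_of_ord _)): kk; rewrite !inordK// => kk; rewrite kk in fb.
move: fb fb'; set e := N.+1%:R^-1; set c := _ * e; rewrite !ler_norml; lra.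
Qed.

(** On one colour class the values of a type in [K] spread over at most [theta + 2 * delta], so they
    surround a grid point within half of that plus [N.+1%:R^-1]. Treating the colours in turn, one
    passes each time to a subset of positive measure on which this grid point is the same for all
    types. *)
Lemma refine_by_color (theta : R) F N (I : finType) (col : tup M ys -> I) (K : set S) :
  (forall b b', col b = col b' -> close_on theta F b b') ->
  compact K -> 0 < mass K -> K `<=` controlled_by theta F ->
  exists C, [/\ compact C, 0 < mass C, C `<=` K & forall p q b, C p -> C q ->
    `|type_val p b - type_val q b| <= theta + 2 * delta + 2 * N.+1%:R^-1].
Proof.
move=> colP cK K0 KF; set e := N.+1%:R^-1; pose D := theta + 2 * delta.
suff H (l : seq I) : exists C, [/\ compact C, 0 < mass C, C `<=` K &
    forall p q b, C p -> C q -> col b \in l ->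
      `|type_val p b - type_val q b| <= D + 2 * e].
  have [C [cC C0 CK Cl]] := H (enum I); exists C; split => // p q b Cp Cq.
  by apply: Cl; rewrite ?mem_enum.
elim: l => [|i l [K' [cK' K'0 K'K K'l]]]; first by exists K; split => // p q b.
pose G k := [set p : S | forall b, col b = i ->
  `|type_val p b - k%:R / N.+1%:R| <= D / 2 + e].
have cG k : closed (G k).
  rewrite (_ : G k = \bigcap_(b in [set b | col b = i])
      [set p : S | [set z | `|z - k%:R / N.+1%:R| <= D / 2 + e] (type_val p b)]).
    apply: closed_bigI => b _; apply: closed_type_val.
    exact: closed_distr_le.
  by apply/seteqP; split=> [p H b /H|p H b /H].
have [|k _ K'k] := mass_closed_cover (cborel cK') K'0 cG (n := N.+2).
  move=> q /K'K/KF qF.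
  have [||r r01 rP] := @midrange R [set type_val q b | b in [set b | col b = i]] D.
  - by move=> _ [b _ <-]; exact: type_val01.
  - by move=> _ _ [b /= bi <-] [b' /= bi' <-]; apply/qF/colP; rewrite bi bi'.
  - have [k kN kr] := unit_grid N r01; exists k => // b bi.
    have := rP _ (ex_intro2 _ _ b bi erefl).
    by move: kr; rewrite -/e; set c := k%:R * e; rewrite !ler_norml; lra.
exists (K' `&` G k); split => //.
- exact: compact_closedI.
- by move=> p [/K'K].
- move=> p q b [K'p Gp] [K'q Gq]; rewrite inE => /predU1P[bi|]; last exact: K'l.
  by move: (Gp b bi) (Gq b bi); rewrite -/e; set c := k%:R * e; rewrite !ler_norml; lra.
Qed.

(* Any constant above [2 * delta] and at most [8 / 3 * delta] would do. *)
Definition Delta : R := 5 / 2 * delta.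

Definition small (C : set S) (F : seq (tup M xs)) :=
  (forall p q b, C p -> C q -> `|type_val p b - type_val q b| <= Delta) /\
  C `<=` controlled_by Delta F.

Definition piece (C : set S) := [/\ compact C, 0 < mass C & exists F, small C F].

Lemma piece_sub (C K : set S) : piece C -> compact K -> 0 < mass K -> K `<=` C -> piece K.
Proof.
move=> [_ _ [F [dC CF]]] cK K0 KC; split => //; exists F; split.
  by move=> p q b /KC Cp /KC Cq; exact: dC.
exact: subset_trans CF.
Qed.

(** Control is used twice: with tiny [theta] to bound the diameter, then with [theta] equal to
    [Delta], since parameters on the other side will only be known to look alike up to [Delta]. *)
Lemma exists_piece (X : set S) : <<s @open S >> X -> 0 < mass X ->
  exists2 C, piece C & C `<=` X.
Proof.
move=> mX X0; have d0 := delta_gt0.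
have [P [cP PX P0]] := inner_compact_gt0 haus mu_inner mX X0.
(* The diameter will be [2 * delta + 4 * N.+1%:R^-1], which is then at most [Delta]. *)
have [N Ne] : exists N, N.+1%:R^-1 <= delta / 8.
  exists (Num.truncn (delta / 8)^-1); rewrite invf_ple ?posrE ?divr_gt0 ?ltr0n//.
  by rewrite ltW// truncnS_gt.
have e0 : 0 < N.+1%:R^-1 :> R by rewrite invr_gt0 ltr0n.
have [F F0] := controlled_piece (theta := 2 * N.+1%:R^-1) (mulr_ge0 (ler0n R 2) (ltW e0)) cP P0.
have cPF : compact (P `&` controlled_by (2 * N.+1%:R^-1) F).
  by apply: compact_closedI => //; exact: closed_controlled_by.
have [I [col colP]] := close_coloring N F.
have [C [cC C0 CP dC]] := refine_by_color N colP cPF F0 (@subIsetr _ _ _).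
have [F' F'0] := controlled_piece (theta := Delta) ltac:(rewrite /Delta; lra) cC C0.
exists (C `&` controlled_by Delta F'); last by move=> p [/CP[/PX]].
split => //; first by apply: compact_closedI => //; exact: closed_controlled_by.
exists F'; split; last exact: subIsetr.
move=> p q b [Cp _] [Cq _]; apply: le_trans (dC p q b Cp Cq) _.
move: Ne; rewrite /Delta; set e := _^-1; lra.
Qed.

(** * Exhausting the type space by finitely many disjoint pieces *)

Local Notation bigU s := (\big[setU/set0]_(X <- s) X).

Lemma compact_bigU (s : seq (set S)) : {in s, forall X, compact X} -> compact (bigU s).
Proof.
elim: s => [_|X s IH sc]; first by rewrite big_nil; exact: compact0.
rewrite big_cons; apply: compactU; first exact/sc/mem_head.
by apply: IH => Y Ys; apply: sc; rewrite inE Ys orbT.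
Qed.

Lemma piece_bigU (s : seq (set S)) : {in s, forall X, piece X} -> <<s @open S >> (bigU s).
Proof. by move=> sp; apply: cborel; apply: compact_bigU => X /sp[]. Qed.

Lemma mem_bigU (s : seq (set S)) X p : X \in s -> X p -> bigU s p.
Proof.
elim: s => // Y s IH; rewrite inE big_cons => /predU1P[<-|Xs] Xp; first by left.
by right; exact: IH.
Qed.

Lemma bigU_mem (s : seq (set S)) p : bigU s p -> exists2 X, X \in s & X p.
Proof.
elim: s => [|Y s IH]; rewrite ?big_nil// big_cons => -[Yp|/IH[X Xs Xp]].
  by exists Y => //; exact: mem_head.
by exists X => //; rewrite inE Xs orbT.
Qed.

(** A countable union [W] of pieces reaches the supremum of the masses of finite unions. A non-null
    complement would contain a further piece, pushing some finite union above the supremum; hence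
    [W] has mass 1, and finite stages approximate it. *)
Lemma pieces_exhaust (e : R) : 0 < e ->
  exists2 s, {in s, forall X, piece X} & mass (~` bigU s) < e.
Proof.
move=> e0; pose V := [set mass (bigU s) | s in [set s | {in s, forall X, piece X}]].
have supV : has_sup V.
  split; first by exists (mass (bigU [::])), [::].
  by exists 1 => _ [s sp <-]; apply: mass_le1; exact: piece_bigU.
have /choice[s sP] k : exists s, {in s, forall X, piece X} /\
    sup V - k.+1%:R^-1 < mass (bigU s).
  have [|_ [s sp <-] lt] := @sup_adherent R V k.+1%:R^-1 _ supV.
    by rewrite invr_gt0 ltr0n.
  by exists s.
pose t n := flatten [seq s k | k <- iota 0 n].
have tp n : {in t n, forall X, piece X}.
  by move=> X /flatten_mapP[k _]; case: (sP k) => + _; exact.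
pose W := \bigcup_n bigU (t n).
have mW : <<s @open S >> W.
  apply: (@bigcup_measurable _ (borel_local_type Phi M)) => n _; exact: piece_bigU.
have sW k : bigU (s k) `<=` W.
  move=> p /bigU_mem[X Xs Xp]; exists k.+1 => //; apply: mem_bigU Xp.
  by apply/flatten_mapP; exists k; rewrite // mem_iota add0n ltnSn.
have W1 : mass W = 1.
  have := massC mu mW; suff : mass (~` W) <= 0 by have := mass_ge0 mu (~` W); lra.
  rewrite leNgt; apply/negP => /(exists_piece (borelC mW))[X pX XW].
  have [_ X0 _] := pX.
  have [k kX] : exists k, k.+1%:R^-1 < mass X.
    exists (Num.truncn (mass X)^-1); rewrite invf_plt ?posrE ?ltr0n//.
    by rewrite truncnS_gt.
  have [skp lt] := sP k.
  have : mass (bigU (X :: s k)) <= sup V.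
    apply: ub_le_sup; first by case: supV.
    by exists (X :: s k) => // Y; rewrite inE => /predU1P[->//|/skp].
  rewrite big_cons massU; first by move: kX lt; set c := _^-1; lra.
  - by apply: cborel; case: pX.
  - exact: piece_bigU.
  - by rewrite -subset0 => p [/XW nW /sW].
have tcvg : mu (bigU (t n)) @[n --> \oo] --> mu W.
  apply: (@nondecreasing_cvg_mu _ (borel_local_type Phi M) R mu (fun n => bigU (t n))).
  - by move=> n; exact: piece_bigU.
  - exact: mW.
  - move=> n m nm; rewrite subsetEset => p /bigU_mem[X /flatten_mapP[k kn Xk] Xp].
    apply: mem_bigU Xp; apply/flatten_mapP; exists k => //.
    by move: kn; rewrite !mem_iota !add0n /= => /leq_trans; apply.
apply: contrapT => nex.
have : (mu W <= (1 - e)%:E)%E.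
  rewrite -(cvg_lim _ tcvg)//; apply: lime_le; first by apply/cvg_ex; exists (mu W).
  apply: nearW => n; rewrite massE; last exact: piece_bigU.
  rewrite lee_fin leNgt; apply/negP => lt; apply: nex; exists (t n) => //.
  by rewrite massC; [lra|exact: piece_bigU].
by rewrite massE// lee_fin W1; lra.
Qed.

Definition disjoint_pieces n (C : nat -> set S) :=
  (forall i, (i < n)%N -> piece (C i)) /\
  (forall i j, (i < j)%N -> (j < n)%N -> C i `&` C j = set0).

Local Notation unionI n C := (\bigcup_(i in `I_n) C i).

Lemma borel_unionI n C : (forall i, (i < n)%N -> compact (C i)) ->
  <<s @open S >> (unionI n C).
Proof.
move=> cC; apply: (@bigcup_measurable _ (borel_local_type Phi M)) => i /cC.
exact: cborel.
Qed.

(** Each new piece is cut down to a compact subset outside the earlier ones, or dropped if hardly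
    anything is left, as pieces need positive mass. The given [C] are kept because the tolerance
    will be measured against the first of them. *)
Lemma disjointify (s : seq (set S)) n C (e : R) : 0 < e ->
  {in s, forall X, piece X} -> disjoint_pieces n C ->
  exists n' C', [/\ (n <= n')%N, disjoint_pieces n' C',
    (forall i, (i < n)%N -> C' i = C i) & mass (bigU s `\` unionI n' C') < e].
Proof.
move=> + + dC; elim: s e => [|X s IH] e e0 sp.
  by exists n, C; split => //; rewrite big_nil set0D /fine_mass measure0.
have Xp : piece X by apply: sp; exact: mem_head.
have {}sp : {in s, forall X, piece X} by move=> Y Ys; apply: sp; rewrite inE Ys orbT.
have e20 : 0 < e / 2 by lra.
have [n1 [C1 [nn1 dC1 C1C lt1]]] := IH _ e20 sp.
have [cX _ _] := Xp; have mX := cborel cX; have ms := piece_bigU sp.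
have mU1 : <<s @open S >> (unionI n1 C1).
  by apply: borel_unionI => i /dC1.1[].
pose Y := X `\` unionI n1 C1; have mY : <<s @open S >> Y by exact: borelD.
have mass_split Z : <<s @open S >> Z ->
    mass ((X `|` bigU s) `\` Z) <= mass (X `\` Z) + mass (bigU s `\` Z).
  move=> mZ; rewrite -lee_fin EFinD -!massE; [|exact: borelD|exact: borelD|].
    by rewrite setDUl; apply: measureU2; exact: borelD.
  by apply: borelD => //; exact: borelU.
rewrite big_cons.
have [Ye|Ye] := ltP (mass Y) (e / 2).
  exists n1, C1; split => //; apply: le_lt_trans (mass_split _ mU1) _.
  by rewrite -/Y; lra.
have [K [cK KY ltK]] := inner_compact haus mu_inner mY e20.
have mK := cborel cK.
have pK : piece K by apply: (piece_sub Xp) => //; [lra|move=> p /KY[]].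
pose C2 i := if (i < n1)%N then C1 i else K.
have dC2 : disjoint_pieces n1.+1 C2.
  split=> [i _|i j ij]; rewrite /C2; first by case: ltnP => // /dC1.1.
  rewrite ltnS => jn; rewrite (leq_trans ij jn).
  case: ltnP => [jn1|_]; first exact: dC1.2.
  rewrite -subset0 => p [C1p /KY[_]]; apply; exists i => //=.
  exact: leq_trans ij jn.
have sub2 : unionI n1 C1 `|` K `<=` unionI n1.+1 C2.
  move=> p [[i /= iln C1p]|Kp].
    by exists i; rewrite /= ?(ltnW iln)// /C2 ?iln// ltnS ltnW.
  by exists n1 => //=; rewrite /C2 ltnn.
have mU2 : <<s @open S >> (unionI n1.+1 C2).
  by apply: borel_unionI => i /dC2.1[].
exists n1.+1, C2; split => //; first exact: leqW.
  by move=> i iln; rewrite /C2 (leq_trans iln nn1) C1C.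
apply: le_lt_trans (mass_split _ mU2) _.
have : mass (bigU s `\` unionI n1.+1 C2) <= mass (bigU s `\` unionI n1 C1).
  apply: mass_le; [exact: borelD|exact: borelD|].
  by move=> p [Bp nU]; split => // ?; apply: nU; apply: sub2; left.
have : mass (X `\` unionI n1.+1 C2) <= mass (Y `\` K).
  apply: mass_le; [exact: borelD|exact: borelD|].
  by move=> p [Bp nU]; split=> [|?]; [split=> // ?|]; apply: nU; apply: sub2; [left|right].
have := massID mu mY mK; rewrite (_ : Y `&` K = K); first by lra.
by apply/setIidPr.
Qed.

(** The first piece is fixed beforehand, so that half of [e * mass C0] can be spent on the
    exhaustion and half on making the pieces disjoint. *)
Lemma exists_disjoint_pieces (e : R) : 0 < e -> exists n C,
  [/\ (0 < n)%N, disjoint_pieces n C & mass (~` unionI n C) <= e * mass (C 0%N)].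
Proof.
move=> e0; have mT : <<s @open S >> [set: S].
  exact: (@measurableT _ (borel_local_type Phi M)).
have [|C0 pC0 _] := exists_piece mT.
  by rewrite /fine_mass probability_setT /= ltr01.
have [_ m0 _] := pC0; pose e' := e * mass C0 / 2.
have e'0 : 0 < e' by rewrite divr_gt0 ?mulr_gt0.
have [s sp slt] := pieces_exhaust e'0.
have [|n [C [n0 dC CC0 lt]]] := @disjointify s 1 (fun=> C0) e' e'0 sp.
  by split=> // i [|j].
exists n, C; split=> //; rewrite CC0//.
have mU : <<s @open S >> (unionI n C) by apply: borel_unionI => i /dC.1[].
have ms := piece_bigU sp.
have : mass (~` unionI n C) <= mass (~` bigU s) + mass (bigU s `\` unionI n C).
  rewrite -massU; [|exact: borelC|exact: borelD|by rewrite setDE setIA setICl set0I].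
  apply: mass_le; [exact: borelC|by apply: borelU; [exact: borelC|exact: borelD]|].
  by move=> p nU; have [?|?] := pselect (bigU s p); [right|left].
by rewrite /e' in slt lt; lra.
Qed.

(** * Enlarging disjoint pieces to disjoint zerosets *)

Local Notation pre Z := (@tp _ _ _ _ _ _ Phi M @^-1` Z).

(** Zerosets are handled as sets of types, where [mu] applies directly; the explicit zeroset is the
    preimage under [tp]. *)
Definition type_zeroset (Z : set S) :=
  [/\ explicit_zeroset Phi M (pre Z), type_algebra Z & closed Z].

Lemma type_algebra_boolean : boolean_algebra (@type_algebra _ _ _ _ _ _ Phi M).
Proof.
split=> [A [[A0 _ _] _] //|Z aZ A AG|Z Z' aZ aZ' A AG]; case: (AG) => -[_ AC AU] _.
  by apply: AC; exact: aZ.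
by apply: AU; [exact: aZ|exact: aZ'].
Qed.

Lemma type_algebraC Z : @type_algebra _ _ _ _ _ _ Phi M Z -> type_algebra (~` Z).
Proof. by case: type_algebra_boolean => _ + _; apply. Qed.

Lemma type_algebraU Z Z' : @type_algebra _ _ _ _ _ _ Phi M Z -> type_algebra Z' ->
  type_algebra (Z `|` Z').
Proof. by case: type_algebra_boolean => _ _; apply. Qed.

Lemma type_algebraI Z Z' : @type_algebra _ _ _ _ _ _ Phi M Z -> type_algebra Z' ->
  type_algebra (Z `&` Z').
Proof.
move=> aZ aZ'; rewrite -[_ `&` _]setCK setCI.
by apply: type_algebraC; apply: type_algebraU; exact: type_algebraC.
Qed.

Lemma induced_measure_pre Z : type_algebra Z -> induced_measure mu (pre Z) = mass Z.
Proof. by move=> aZ; rewrite /induced_measure type_set_preimage. Qed.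

Lemma type_zeroset_val b (D : set R) : closed D ->
  type_zeroset [set p | D (type_val p b)].
Proof.
move=> cD; split; last exact: closed_type_val.
  by apply: sub_gen_smallest; exists b, D.
by apply: sub_gen_smallest; exists b, D.
Qed.

Lemma type_zerosetU Z Z' : type_zeroset Z -> type_zeroset Z' -> type_zeroset (Z `|` Z').
Proof.
move=> [eZ aZ cZ] [eZ' aZ' cZ']; split; [|exact: type_algebraU|exact: closedU].
by move=> A AG; case: (AG) => -[AU AI] _; apply: AU; [exact: eZ|exact: eZ'].
Qed.

Lemma type_zerosetI Z Z' : type_zeroset Z -> type_zeroset Z' -> type_zeroset (Z `&` Z').
Proof.
move=> [eZ aZ cZ] [eZ' aZ' cZ']; split; [|exact: type_algebraI|exact: closedI].
by move=> A AG; case: (AG) => -[AU AI] _; apply: AI; [exact: eZ|exact: eZ'].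
Qed.

Lemma type_zerosetT : type_zeroset setT.
Proof. exact: (@type_zeroset_val (some_tup M) setT closedT). Qed.

Lemma type_zeroset0 : type_zeroset set0.
Proof. exact: (@type_zeroset_val (some_tup M) set0 closed0). Qed.

Definition separated (X Y : set S) := exists Z Z',
  [/\ type_zeroset Z, type_zeroset Z', X `<=` Z, Y `<=` Z' & Z `&` Z' = set0].

Lemma separatedC X Y : separated X Y -> separated Y X.
Proof. by move=> [Z [Z' [? ? ? ? ?]]]; exists Z', Z; rewrite setIC. Qed.

Lemma separatedS X X' Y Y' : X' `<=` X -> Y' `<=` Y -> separated X Y -> separated X' Y'.
Proof.
by move=> XX YY [Z [Z' [? ? XZ YZ ?]]]; exists Z, Z'; split => //;
  [exact: subset_trans XZ|exact: subset_trans YZ].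
Qed.

Lemma separated0 Y : separated set0 Y.
Proof.
exists set0, setT; split => //; [exact: type_zeroset0|exact: type_zerosetT|].
exact: set0I.
Qed.

Lemma separatedU X X' Y : separated X Y -> separated X' Y -> separated (X `|` X') Y.
Proof.
move=> [Z [W [zZ zW XZ YW ZW]]] [Z' [W' [zZ' zW' XZ' YW' ZW']]].
exists (Z `|` Z'), (W `&` W'); split.
- exact: type_zerosetU.
- exact: type_zerosetI.
- exact: setUSS.
- by move=> p Yp; split; [exact: YW|exact: YW'].
- by rewrite setIUl setIA ZW set0I set0U setIC -setIA [W' `&` _]setIC ZW' setI0.
Qed.

(** As in the normality of compact Hausdorff spaces, compactness is applied to [K] for each point of
    [C], and then to [C]. *)
Lemma separate_compact (C K : set S) : compact C -> compact K -> C `&` K = set0 ->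
  separated C K.
Proof.
move=> cC cK CK.
apply: (compact_ideal (I := fun X => separated X K) cC).
- exact: separated0.
- by move=> X Y; exact: separatedU.
- by move=> X Y XY; exact: separatedS.
move=> p Cp; have [U oU sU] : exists2 U, open_nbhs p U & separated U K; last by exists U.
apply: (compact_ideal (I := fun X => exists2 U, open_nbhs p U & separated U X) cK).
- exists setT; first by split => //; exact: openT.
  by apply: separatedC; exact: separated0.
- move=> X Y [U oU UX] [V oV VY]; exists (U `&` V); first exact: open_nbhsI.
  apply: separatedC; apply: separatedU; apply: separatedC.
    exact: separatedS UX.
  exact: separatedS VY.
- by move=> X Y XY [U oU UY]; exists U => //; exact: separatedS UY.
move=> q Kq; have pq : p <> q by move=> pq; move: CK; rewrite -subset0 => /(_ q); apply; split; [rewrite -pq|].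
have [b [t [u [tu pqb]]]] := type_val_separates pq.
have nlt (r : S) v : type_val r b < v -> open_nbhs r [set s : S | type_val s b < v].
  by move=> rv; split => //; apply: (@open_type_val _ _ _ _ _ _ _ _ b [set z | z < v]); exact: open_lt.
have ngt (r : S) v : v < type_val r b -> open_nbhs r [set s : S | v < type_val s b].
  by move=> rv; split => //; apply: (@open_type_val _ _ _ _ _ _ _ _ b [set z | v < z]); exact: open_gt.
have sep : separated [set s | type_val s b < t] [set s | u < type_val s b].
  exists [set s | [set z | z <= t] (type_val s b)], [set s | [set z | u <= z] (type_val s b)]; split.
  - by apply: type_zeroset_val; exact: closed_le.
  - by apply: type_zeroset_val; exact: closed_ge.
  - by move=> s /ltW.
  - by move=> s /ltW.
  - by rewrite -subset0 => s [] /= st us; have := lt_le_trans tu (le_trans us st); rewrite ltxx.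
case: pqb => -[pb qb].
  by exists [set s | u < type_val s b]; [exact: ngt|exists [set s | type_val s b < t]; [exact: nlt|]].
exists [set s | type_val s b < t]; first exact: nlt.
by exists [set s | u < type_val s b]; [exact: ngt|exact: separatedC].
Qed.

(** A zeroset separated from a compact set filling most of the complement of [C] has mass at most
    [(1 + gamma) * mass C], and [(1 - gamma) * (1 + gamma) <= 1]. *)
Lemma outer_zeroset (C : set S) (gamma : R) : 0 < gamma < 1 -> compact C ->
  0 < mass C -> exists Z, [/\ type_zeroset Z, C `<=` Z & (1 - gamma) * mass Z <= mass C].
Proof.
move=> /andP[g0 g1] cC C0; have mC := cborel cC.
have [K [cK KC ltK]] := inner_compact haus mu_inner (borelC mC) (mulr_gt0 g0 C0).
have [|Z [Z' [zZ zZ' CZ KZ' ZZ']]] := separate_compact cC cK.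
  by rewrite -subset0 => p [Cp /KC].
exists Z; split => //; have [_ _ cZ] := zZ.
have mK := cborel cK; have mZ := closed_borel cZ.
have : mass Z <= mass (~` K).
  apply: mass_le => //; first exact: borelC.
  by move=> p Zp /KZ' Z'p; move: ZZ'; rewrite -subset0 => /(_ p); apply.
move: ltK; rewrite !massC// => ltK leZ.
have : (1 - gamma) * mass Z <= (1 - gamma) * ((1 + gamma) * mass C).
  by apply: ler_wpM2l; lra.
have : 0 <= gamma * gamma * mass C by rewrite !mulr_ge0// ltW.
by lra.
Qed.

(** The new piece is separated from the union of the old ones by zerosets [Y'] and [Y], with which
    the new and the old zerosets are intersected; shrinking preserves the mass bound. *)
Lemma disjoint_zerosets n (C : nat -> set S) (gamma : R) :
  0 < gamma < 1 -> disjoint_pieces n C -> exists Z : nat -> set S,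
  (forall i, (i < n)%N -> [/\ type_zeroset (Z i), C i `<=` Z i &
     (1 - gamma) * mass (Z i) <= mass (C i)]) /\
  (forall i j, (i < j)%N -> (j < n)%N -> Z i `&` Z j = set0).
Proof.
move=> g01; elim: n => [|n IH] [pC dC]; first by exists (fun=> set0).
have [|Z [ZP dZ]] := IH.
  by split=> [i iln|i j ij jn]; [apply: pC; exact: leqW|apply: dC => //; exact: leqW].
have [cCn Cn0 _] := pC n (ltnSn n).
have [Q [zQ CQ QC]] := outer_zeroset g01 cCn Cn0.
have [||Y [Y' [zY zY' UY CY' YY']]] := @separate_compact (unionI n C) (C n) _ cCn.
- rewrite bigcup_mkord; apply: bigsetU_compact => i _.
  by case: (pC i (leqW (ltn_ord i))).
- by rewrite -subset0 => p [[i iln Cip] Cnp]; rewrite -(dC i n iln (ltnSn n)).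
have le_part (X X' : set S) : type_zeroset X -> type_zeroset X' ->
    (1 - gamma) * mass (X `&` X') <= (1 - gamma) * mass X.
  move=> zX zX'; apply: ler_wpM2l; first by case/andP: g01 => _ /ltW; rewrite subr_ge0.
  have [_ _ cX] := zX; have [_ _ cXX'] := type_zerosetI zX zX'.
  by apply: mass_le; [exact: closed_borel|exact: closed_borel|exact: subIsetl].
exists (fun i => if (i < n)%N then Z i `&` Y else Q `&` Y'); split=> [i|i j ij].
  rewrite ltnS leq_eqVlt => /predU1P[->|iln]; rewrite ?ltnn ?iln.
    split; first exact: type_zerosetI.
    - by move=> p Cp; split; [exact: CQ|exact: CY'].
    - exact: le_trans (le_part _ _ zQ zY') QC.
  have [zZ CZ ZC] := ZP i iln; split; first exact: type_zerosetI.
  - by move=> p Cp; split; [exact: CZ|apply: UY; exists i].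
  - exact: le_trans (le_part _ _ zZ zY) ZC.
rewrite ltnS leq_eqVlt => /predU1P[jn|jn].
  rewrite jn ltnn -jn ij -subset0 => p [[_ Yp] [_ Y'p]].
  by rewrite -YY'.
rewrite jn (ltn_trans ij jn) -subset0 => p [[Zi _] [Zj _]].
by rewrite -(dZ i j ij jn).
Qed.

Lemma mass_gt0_neq0 (X : set S) : 0 < mass X -> X !=set0.
Proof. by move=> X0; apply/set0P/eqP => XE; move: X0; rewrite XE /fine_mass measure0 ltxx. Qed.

(** * Zerosets mostly filled by one piece *)

Section Neighbourhood.
Variables (C Z : set S) (F : seq (tup M xs)) (gamma : R).
Hypotheses (cC : compact C) (C0 : 0 < mass C) (sC : small C F).
Hypotheses (zZ : type_zeroset Z) (CZ : C `<=` Z).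
Hypothesis ZC : (1 - gamma) * mass Z <= mass C.

Lemma mass_between (Y : set S) : type_zeroset Y -> C `<=` Y ->
  (1 - gamma) * induced_measure mu (pre Z) <= induced_measure mu (pre Y).
Proof.
move=> [_ aY cY] CY; have [_ aZ _] := zZ; rewrite !induced_measure_pre//.
by apply: (le_trans ZC); apply: mass_le => //; [exact: cborel|exact: closed_borel].
Qed.

Lemma concentrated (W : set (tup M ys)) :
  (forall b b', W b -> W b' -> close_on Delta F b b') ->
  exists r, 0 <= r <= 1 /\ forall b, W b ->
    (1 - gamma) * induced_measure mu (pre Z) <=
    induced_measure mu [set a | pre Z a /\ `|f a b - r| <= 5 * delta].
Proof.
move=> WF; have [dC CF] := sC; have d0 := delta_gt0.
have [p Cp] := mass_gt0_neq0 C0.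
have [||r r01 rP] := @midrange R [set type_val p b | b in W] (Delta + 2 * delta).
- by move=> _ [b _ <-]; exact: type_val01.
- by move=> _ _ [b Wb <-] [b' Wb' <-]; apply: CF => //; exact: WF.
exists r; split => // b Wb.
pose Y := Z `&` [set q | [set z | `|z - r| <= 5 * delta] (type_val q b)].
apply: (@mass_between Y).
  by apply: type_zerosetI => //; apply: type_zeroset_val; exact: closed_distr_le.
move=> q Cq; split; first exact: CZ.
(* The error is [Delta + (Delta + 2 * delta) / 2], that is, [19 / 4 * delta]. *)
have := rP _ (ex_intro2 _ _ b Wb erefl); have := dC q p b Cq Cp.
by rewrite /= /Delta !ler_norml; lra.
Qed.

(** For each [b] in [G], values are restricted to within [Delta / 2] of the midpoint of those on
    [C]. These finitely many closed conditions hold on all of [C], so little mass is lost. *)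
Lemma oscillation_subset (G : seq (tup M ys)) : exists V : set (tup M xs),
  [/\ V `<=` pre Z, explicit_algebra Phi M V,
    (1 - gamma) * induced_measure mu (pre Z) <= induced_measure mu V &
    forall a a', V a -> V a' -> {in G, forall b, `|f a b - f a' b| <= Delta}].
Proof.
have [dC _] := sC.
have [Y [zY CY YG]] : exists Y, [/\ type_zeroset Y, C `<=` Y & forall a a',
    pre Y a -> pre Y a' -> {in G, forall b, `|f a b - f a' b| <= Delta}].
  elim: G => [|b G [Y [zY CY YG]]].
    by exists setT; split => //; exact: type_zerosetT.
  have [||r r01 rP] := @midrange R [set type_val p b | p in C] Delta.
  - by move=> _ [p _ <-]; exact: type_val01.
  - by move=> _ _ [p Cp <-] [q Cq <-]; exact: dC.
  exists (Y `&` [set q | [set z | `|z - r| <= Delta / 2] (type_val q b)]); split.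
  - by apply: type_zerosetI => //; apply: type_zeroset_val; exact: closed_distr_le.
  - by move=> p Cp; split; [exact: CY|apply: rP; exists p].
  - move=> a a' [Ya ra] [Ya' ra'] b'; rewrite inE => /predU1P[->|]; last exact: YG.
    have {}ra : `|f a b - r| <= Delta / 2 := ra.
    have {}ra' : `|f a' b - r| <= Delta / 2 := ra'.
    by move: ra ra'; rewrite !ler_norml; lra.
have zZY := type_zerosetI zZ zY.
exists (pre (Z `&` Y)); split.
- by move=> a [].
- by case: zZY => + _ _; exact: sub_gen_smallest.
- by apply: mass_between => // p Cp; split; [exact: CZ|exact: CY].
- by move=> a a' [_ Ya] [_ Ya']; exact: YG.
Qed.

End Neighbourhood.

(** The pieces, hence [n] and the control sets [F], precede [gamma]; only the zerosets depend on it.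
    [W] and [G] are left open so that the other side can supply them. *)
Lemma one_sided_partition (eps : R) : 0 < eps ->
  exists n (F : nat -> seq (tup M xs)), (0 < n)%N /\
  forall gamma : R, 0 < gamma < 1 -> exists A : nat -> set (tup M xs),
  [/\ disjoint_cover n A,
    forall i, (1 <= i <= n)%N -> explicit_zeroset Phi M (A i),
    induced_measure mu (A 0%N) <= eps * induced_measure mu (A 1%N),
    (forall i (W : set (tup M ys)), (1 <= i <= n)%N ->
      (forall b b', W b -> W b' -> close_on Delta (F i) b b') ->
      exists r, 0 <= r <= 1 /\ forall b, W b ->
        (1 - gamma) * induced_measure mu (A i) <=
        induced_measure mu [set a | A i a /\ `|f a b - r| <= 5 * delta]) &
    (forall i (G : seq (tup M ys)), (1 <= i <= n)%N -> exists V : set (tup M xs),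
      [/\ V `<=` A i, explicit_algebra Phi M V,
        (1 - gamma) * induced_measure mu (A i) <= induced_measure mu V &
        forall a a', V a -> V a' -> {in G, forall b, `|f a b - f a' b| <= Delta}])].
Proof.
move=> eps0; have [n [C [n0 dC lt]]] := exists_disjoint_pieces eps0.
have [F FP] : exists F : nat -> seq (tup M xs), forall i, (i < n)%N -> small (C i) (F i).
  suff : forall i, exists Fi, (i < n)%N -> small (C i) Fi.
    by move=> /choice[F FP]; exists F.
  move=> i; have [iln|?] := ltnP i n; last by exists [::].
  by have [_ _ [Fi]] := dC.1 i iln; exists Fi.
(* Block 0 is the leftover, so piece [i] becomes block [i.+1]. *)
exists n, (fun i => F i.-1); split => // gamma g01.
have [Z [ZP dZ]] := disjoint_zerosets g01 dC.
have alg k : (k <= n)%N -> type_algebra (unionI k Z).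
  elim: k => [_|k IH kn].
    by rewrite bigcup_mkord big_ord0; case: type_zeroset0 => _ aZ _.
  rewrite bigcup_mkord big_ord_recr /= -bigcup_mkord.
  by apply: type_algebraU; [apply: IH; exact: ltnW|case: (ZP k kn) => -[_ aZ _] _ _].
pose A i := if i is i'.+1 then pre (Z i') else pre (~` unionI n Z).
exists A; split.
- split.
    move=> [|i] [|j] //= iln jln [a []] /=.
    + by move=> nZ Zj; case: nZ; exists j.
    + by move=> Zi nZ; case: nZ; exists i.
    + move=> Zi Zj; congr _.+1; have [ij|ji|//] := ltngtP i j.
        by have := dZ i j ij jln; rewrite -subset0 => /(_ (tp Phi a)) [].
      by have := dZ j i ji iln; rewrite -subset0 => /(_ (tp Phi a)) [].
  rewrite -subTset => a _; have [[i iln Zi]|nZ] := pselect (unionI n Z (tp Phi a)).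
    by exists i.+1.
  by exists 0%N.
- by case=> [|i] // /andP[_ iln]; case: (ZP i iln) => -[eZ _ _] _ _.
- have [zZ0 CZ0 _] := ZP 0%N n0; have [_ aZ0 cZ0] := zZ0.
  rewrite /= !induced_measure_pre//; last by apply: type_algebraC; exact: alg.
  have mU : <<s @open S >> (unionI n Z).
    apply: (@bigcup_measurable _ (borel_local_type Phi M)) => i iln.
    by have [[_ _ cZ] _ _] := ZP i iln; exact: closed_borel.
  have mC : <<s @open S >> (unionI n C) by apply: borel_unionI => i /dC.1[].
  have [cC0 _ _] := dC.1 _ n0.
  (* Passing from pieces to zerosets shrinks the leftover and enlarges the first block. *)
  apply: (@le_trans _ _ (mass (~` unionI n C))).
    apply: mass_le; [exact: borelC|exact: borelC|apply: subsetC].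
    by move=> p [i iln Cp]; exists i => //; case: (ZP i iln) => _ + _; apply.
  apply: (le_trans lt); apply: ler_wpM2l; first exact: ltW.
  by apply: mass_le => //; [exact: cborel|exact: closed_borel].
- move=> [|i] // W /andP[_ iln]; have [cCi Ci0 _] := dC.1 i iln.
  have [zZ CZ ZC] := ZP i iln.
  exact: (concentrated cCi Ci0 (FP i iln) zZ CZ ZC).
- move=> [|i] // G /andP[_ iln]; have [cCi Ci0 _] := dC.1 i iln.
  have [zZ CZ ZC] := ZP i iln.
  exact: (oscillation_subset cCi (FP i iln) zZ CZ ZC).
Qed.

End Pieces.

(** * Coupling the partitions of the two sides *)

Section Realization.
Context {R : realType} {L : language R} {x y : finType}.
Context {xs : x -> lsort L} {ys : y -> lsort L}.

(** [Phi] need only agree with a formula pointwise, which covers [swapb (interp phi)] as well. *)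
Lemma local_type_finitely_realized (Phi : bpred xs ys)
    (phi : formula (joinv xs ys)) (M : structure L) :
  (forall N a b, Phi N a b = interp phi N a b) -> omega_saturated M ->
  forall (p : local_type Phi M) (s : seq (tup M ys)),
  exists a, {in s, forall b, Phi M a b = type_val p b}.
Proof.
move=> PhiE satM p s.
have [N [h [a [elh pE]]]] : is_local_type Phi (type_val p) := set_valP p.
have [a0 a0P] := finitely_realized phi a
  (fun i : 'I_(size s) => nth (@some_tup R L y ys M) s i) satM elh.
exists a0 => b bs; have := a0P (Ordinal (etrans (index_mem b s) bs)).
by rewrite /= nth_index// -!PhiE => ->; rewrite pE.
Qed.

End Realization.

Theorem theorem4p6 (R : realType) (L : language R) (T : theory L)
    (M : structure L) (x y : finType) (xs : x -> lsort L) (ys : y -> lsort L)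
    (phi : formula (joinv xs ys)) (delta : R)
    (mu : probability (borel_local_type (interp phi) M) R)
    (nu : probability (borel_local_type (swapb (interp phi)) M) R)
    (eps : R)
    (countableL : countable_language L)
    (completeT : complete_theory T)
    (MT : models M T)
    (satM : omega_saturated M)
    (phi01 : unit_valued T phi)
    (stable_phi : stable T phi delta)
    (mu_regular : regular_measure mu)
    (nu_regular : regular_measure nu)
    (eps_gt0 : 0 < eps) :
  exists m n : nat, [/\ (1 <= m)%N, (1 <= n)%N &
    forall gamma : R, 0 < gamma < 1 ->
    exists (A : nat -> set (tup M xs)) (B : nat -> set (tup M ys)),
      disjoint_cover m A /\ disjoint_cover n B /\
      [/\ (forall i, (1 <= i <= m)%N -> explicit_zeroset (interp phi) M (A i)) /\
          (forall j, (1 <= j <= n)%N ->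
             explicit_zeroset (swapb (interp phi)) M (B j)),
          forall i j, (1 <= i <= m)%N -> (1 <= j <= n)%N ->
            homogeneous (interp phi M)
              (explicit_algebra (interp phi) M)
              (explicit_algebra (swapb (interp phi)) M)
              (induced_measure mu) (induced_measure nu) (5 * delta) gamma (A i) (B j) &
          induced_measure mu (A 0%N) <= eps * induced_measure mu (A 1%N) /\
          induced_measure nu (B 0%N) <= eps * induced_measure nu (B 1%N)]].
Proof.
have f01 a b : 0 <= interp phi M a b <= 1 by exact: phi01.
have stableM := stable_phi M MT.
(* Stability is symmetric: exchanging the two sequences only changes the sign of the difference. *)
have stableM' : ~ exists (b : nat -> tup M ys) (a : nat -> tup M xs), forall i j,
    (i < j)%N -> delta <= `|swapb (interp phi) M (b i) (a j) -
                            swapb (interp phi) M (b j) (a i)|.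
  move=> [b [a ab]]; apply: stableM; exists a, b => i j /ab.
  by rewrite /swapb distrC.
have mu_inner X (mX : <<s @open (local_type (interp phi) M) >> X) := (mu_regular X mX).1.
have nu_inner X (mX : <<s @open (local_type (swapb (interp phi)) M) >> X) :=
  (nu_regular X mX).1.
have realx := local_type_finitely_realized (fun N a b => erefl (interp phi N a b)) satM.
have realy := @local_type_finitely_realized _ _ _ _ _ _ (swapb (interp phi))
  (swap_formula phi) M (fun N b a => esym (interp_swap phi a b)) satM.
have [m [F [m0 HA]]] := one_sided_partition f01 realx stableM mu_inner eps_gt0.
have [n [G [n0 HB]]] :=
  one_sided_partition (fun b a => f01 a b) realy stableM' nu_inner eps_gt0.
exists m, n; split => // gamma g01.
have [A [coverA zA epsA concA oscA]] := HA gamma g01.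
have [B [coverB zB epsB concB oscB]] := HB gamma g01.
exists A, B; do 2!split => //; split => // i j im jn; split.
- by apply: sub_gen_smallest; exact: zA.
- by apply: sub_gen_smallest; exact: zB.
(* Each side is restricted according to the control set of the other: [V] varies little on [G j],
   which yields [s], and [W] varies little on [F i], which yields [r]. *)
have [V [VA aV muV VG]] := oscA i (G j) im.
have [W [WB aW nuW WF]] := oscB j (F i) jn.
exists V, W; split => //.
- by apply: concA => // b b' Wb Wb'; exact: WF.
- by apply: concB => // a a' Va Va'; exact: VG.
Qed.
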